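(* Let $\alpha\in(0,2)$ and let $V$ be a measurable function on $\mathbb R^d$ with $\int_{\mathbb R^d}e^{-V(x)}\,dx<\infty$, so that $\mu_V$ is a well-defined probability measure. Consider the condition $$( * )\qquad \limsup_{r\to\infty}\Big\{r^{d+\alpha-1}\sup_{|x|\ge r-1}|\nabla e^{-V}(x)|+r^{d+\alpha-2}\sup_{|x|\ge r-1}e^{-V(x)}\Big\}=0.$$ (1) If $e^{-V}\in C_b^2(\mathbb R^d)$ is such that $( * )$ holds, and $\Phi(0)>0$, then the Poincaré inequality $$\mu_V(f^2)\le C\,\mathscr E_{\alpha,V}(f,f),\qquad f\in\mathscr D(\mathscr E_{\alpha,V}),\ \mu_V(f)=0,$$ holds for some constant $C>0$. (2) If $e^{-V}\in C_b^2(\mathbb R^d)$ is such that $( * )$ holds, and $\Phi(r)\uparrow\infty$ as $r\uparrow\infty$, then there exist constants $c_1,c_2>0$ such that the super Poincaré inequality $$\mu_V(f^2)\le r\,\mathscr E_{\alpha,V}(f,f)+\beta(r)\,\mu_V(|f|)^2,\qquad r>0,\ f\in\mathscr D(\mathscr E_{\alpha,V}),$$ holds for $$\beta(r)=c_1\Big(1+r^{-d/\alpha}\big\{h\circ\Phi^{-1}(c_2r^{-1})\big\}^{-1-d/\alpha}\big\{H\circ\Phi^{-1}(c_2r^{-1})\big\}^{2+d/\alpha}\Big),\qquad r>0.$$ (3) There exists a universal constant $c>0$ such that the weak Poincaré inequality $$\mu_V(f^2)\le\tilde\beta(r)\,\mathscr E_{\alpha,V}(f,f)+r\|f\|_\infty^2,\qquad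 r>0,\ f\in\mathscr D(\mathscr E_{\alpha,V}),\ \mu_V(f)=0,$$ holds for $$\tilde\beta(r):=\inf\Big\{\big(c\,\Psi_1(R)\big)\wedge\Psi_2(R):\ \mu_V(B(0,R)^c)\le\frac{r}{1+r}\Big\}<\infty,\qquad r>0.$$
   Context: $\mu_V(dx):=\big(\int_{\mathbb R^d}e^{-V(y)}\,dy\big)^{-1}e^{-V(x)}\,dx$ and $\mu_V(f):=\int f\,d\mu_V$. The stable-like Dirichlet form is $$\mathscr E_{\alpha,V}(f,g):=\iint_{\mathbb R^d\times\mathbb R^d}\frac{(f(x)-f(y))(g(x)-g(y))}{|x-y|^{d+\alpha}}\,dy\,\mu_V(dx),\qquad \mathscr D(\mathscr E_{\alpha,V}):=\{f\in L^2(\mu_V):\mathscr E_{\alpha,V}(f,f)<\infty\}.$$ $B(0,r)$ is the ball of radius $r$ centred at $0$, $B(0,r)^c$ its complement, and $C_b^2(\mathbb R^d)$ is the set of $C^2$ functions bounded together with their derivatives up to order 2. Define $$h(r)=\inf_{|x|\le r}e^{V(x)},\quad H(r)=\sup_{|x|\le r}e^{V(x)},\quad \Phi(r)=\inf_{|x|\ge r}\frac{e^{V(x)}}{(1+|x|)^{d+\alpha}},$$ $$\Phi^{-1}(r)=\inf\{s\ge0:\Phi(s)\ge r\}\quad(\inf\emptyset=\infty),$$ $$\Psi_1(r)=\Big(\sup_{|x|\le r}\frac{(1+|x|)^{d+\alpha}}{e^{V(x)}}\Big)\sup_{x\in\mathbb R^d}\frac{e^{V(x)}}{(1+|x|)^{d+\alpha}},$$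 $$\Psi_2(r)=\frac{1}{\mu_V(B(0,r))^2}\sup_{x\in B(0,r)}\int_{B(0,r)}|y-x|^{d+\alpha}e^{-2V(y)}\,dy,\qquad r>0,$$ where $\Phi$ is also defined at $r=0$ by the same formula.
   Formalization: In (3), Ψ_2 is multiplied by (∫e^{-V}dx)^{-2} (as printed, the claim fails when V is shifted by a constant), β̃(r)<∞ is claimed only when e^{-2V} is locally integrable (it fails otherwise), and the universal constant c may depend on d only. *)

(* Defs.v *)
From HB Require Import structures.
From mathcomp Require Import all_boot all_order all_algebra.
From mathcomp Require Import all_classical all_reals all_analysis.
From mathcomp Require Import measurable_realfun ess_sup_inf.

Set Implicit Arguments.
Unset Strict Implicit.
Unset Printing Implicit Defensive.

Import Order.TTheory GRing.Theory Num.Theory.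
Import numFieldNormedType.Exports.

Local Open Scope classical_set_scope.
Local Open Scope ring_scope.

(* 'rV[R]_d carries the product sigma-algebra, generated by the coordinates,
   as n.-tuple T does in the library. *)
Section measurable_rV.
Context {R : realType}.
Variable d : nat.

Let coord (i : 'I_d) (x : 'rV[R]_d) : R := x ord0 i.

Let rV_set0 : g_sigma_preimage coord set0.
Proof. exact: sigma_algebra0. Qed.

Let rV_setC A : g_sigma_preimage coord A -> g_sigma_preimage coord (~` A).
Proof. exact: sigma_algebraC. Qed.

Let rV_bigcup (F : (set 'rV[R]_d)^nat) :
  (forall i, g_sigma_preimage coord (F i)) ->
  g_sigma_preimage coord (\bigcup_i (F i)).
Proof. exact: sigma_algebra_bigcup. Qed.

HB.instance Definition _ := @isMeasurable.Build default_measure_display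
  'rV[R]_d (g_sigma_preimage coord) rV_set0 rV_setC rV_bigcup.

End measurable_rV.

Section measurable_rV_lemmas.
Context {R : realType}.

Lemma measurable_rV_coord d (i : 'I_d) :
  measurable_fun setT (fun x : 'rV[R]_d => x ord0 i).
Proof.
move=> _ Y mY; rewrite setTI; apply: sub_sigma_algebra => /=.
rewrite -bigcup_seq/=; exists i => /=; first by rewrite mem_index_enum.
by exists Y => //; rewrite setTI.
Qed.

Lemma measurable_rVP d d' (T : measurableType d') (f : T -> 'rV[R]_d) :
  (forall i, measurable_fun setT (fun t => f t ord0 i)) ->
  measurable_fun setT f.
Proof.
move=> mf _ A mA; rewrite setTI.
have : (g_sigma_preimage (fun i t => f t ord0 i)) (f @^-1` A).
  rewrite (@g_sigma_preimage_comp _ R d 'rV[R]_d (fun i x => x ord0 i) T f).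
  by exists A => //; rewrite setTI.
apply: smallest_sub; first exact: sigma_algebra_measurable.
rewrite -bigcup_seq/=; apply: bigcup_sub => i _ B [C mC <-].
exact: mf.
Qed.

Definition rV_cons d (p : measurableTypeR R * 'rV[R]_d) : 'rV[R]_d.+1 :=
  \row_i (if unlift ord0 i is Some j then p.2 ord0 j else p.1).

Lemma measurable_rV_cons d : measurable_fun setT (@rV_cons d).
Proof.
apply: measurable_rVP => i.
case: (unliftP ord0 i) => [j|] ->.
- rewrite (_ : (fun _ => _) = (fun x : 'rV[R]_d => x ord0 j) \o snd).
    exact: (measurableT_comp (measurable_rV_coord j) measurable_snd).
  by apply/funext => p; rewrite mxE liftK.
- rewrite (_ : (fun _ => _) = fst); first exact: measurable_fst.
  by apply/funext => p; rewrite mxE unlift_none.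
Qed.

Definition rV_uncons d (x : 'rV[R]_d.+1) : measurableTypeR R * 'rV[R]_d :=
  (x ord0 ord0, \row_j x ord0 (lift ord0 j)).

Lemma measurable_rV_uncons d : measurable_fun setT (@rV_uncons d).
Proof.
apply/measurable_fun_pairP; split; first exact: measurable_rV_coord.
apply: measurable_rVP => i /=.
rewrite (_ : (fun _ => _) = fun x : 'rV[R]_d.+1 => x ord0 (lift ord0 i)).
  exact: measurable_rV_coord.
by apply/funext => x; rewrite mxE.
Qed.

Lemma rV_consK d : cancel (@rV_cons d) (@rV_uncons d).
Proof.
move=> [t x]; rewrite /rV_uncons mxE unlift_none; congr pair.
by apply/rowP => j; rewrite !mxE liftK.
Qed.

End measurable_rV_lemmas.


Section lebesgue_rV.
Context {R : realType}.
Local Open Scope ereal_scope.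

Section step.
Variables (d : nat) (m : {sigma_finite_measure set 'rV[R]_d -> \bar R}).

Definition lebesgue_rV_cons : set 'rV[R]_d.+1 -> \bar R :=
  pushforward (lebesgue_measure \x m) (@rV_cons R d).

Let cons_measurable (A : set 'rV[R]_d.+1) :
  measurable A -> measurable (@rV_cons R d @^-1` A).
Proof. by move=> mA; rewrite -[X in measurable X]setTI; exact: measurable_rV_cons. Qed.

Let lebesgue_rV_cons0 : lebesgue_rV_cons set0 = 0.
Proof. by rewrite /lebesgue_rV_cons /pushforward preimage_set0 measure0. Qed.

Let lebesgue_rV_cons_ge0 A : 0 <= lebesgue_rV_cons A.
Proof. by rewrite /lebesgue_rV_cons /pushforward; exact: measure_ge0. Qed.

Let lebesgue_rV_cons_sigma_additive : semi_sigma_additive lebesgue_rV_cons.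
Proof.
move=> F mF tF mUF; rewrite /lebesgue_rV_cons /pushforward preimage_bigcup.
apply: measure_semi_sigma_additive.
- by move=> n; exact: cons_measurable.
- apply/trivIsetP => /= i j _ _ ij; rewrite -preimage_setI.
  by move/trivIsetP : tF => /(_ _ _ _ _ ij) ->//; rewrite preimage_set0.
- by rewrite -preimage_bigcup; exact: cons_measurable.
Qed.

HB.instance Definition _ := isMeasure.Build _ _ _ lebesgue_rV_cons
  lebesgue_rV_cons0 lebesgue_rV_cons_ge0 lebesgue_rV_cons_sigma_additive.

Let lebesgue_rV_cons_sigma_finite : sigma_finite setT lebesgue_rV_cons.
Proof.
have /sigma_finiteP[F [TF ndF Foo]] := sigma_finiteT (@lebesgue_measure R).
have /sigma_finiteP[G [TG ndG Goo]] := sigma_finiteT m.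
exists (fun n => @rV_uncons R d @^-1` (F n `*` G n)).
  rewrite -preimage_bigcup (_ : \bigcup_n _ = setT) ?preimage_setT//.
  rewrite -setXTT TF TG predeqE => -[x y]; split.
    by move=> [n _ []/= ? ?]; split; exists n.
  move=> [/= [n _ Fnx] [k _ Gky]]; exists (maxn n k) => //; split.
  - by move: x Fnx; exact/subsetPset/ndF/leq_maxl.
  - by move: y Gky; exact/subsetPset/ndG/leq_maxr.
move=> k; have [mF Fkoo] := Foo k; have [mG Gkoo] := Goo k; split.
  rewrite -[X in measurable X]setTI.
  by apply: measurable_rV_uncons => //; exact: measurableX.
rewrite /lebesgue_rV_cons /pushforward -comp_preimage.
rewrite (_ : _ \o _ = idfun); last by apply/funext => p /=; rewrite rV_consK.
by rewrite preimage_id product_measure1E// lte_mul_pinfty// ge0_fin_numE.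
Qed.

HB.instance Definition _ := @Measure_isSigmaFinite.Build _ _ _
  lebesgue_rV_cons lebesgue_rV_cons_sigma_finite.

End step.

Fixpoint lebesgue_rV (d : nat) : {sigma_finite_measure set 'rV[R]_d -> \bar R} :=
  match d with
  | 0 => @dirac _ 'rV[R]_0 0%R R
  | d'.+1 => lebesgue_rV_cons (lebesgue_rV d')
  end.

End lebesgue_rV.

Section euclidean.
Context {R : realType} {d : nat}.

(* The library's norm on 'rV[R]_d is the sup norm. *)
Definition enorm (x : 'rV[R]_d) : R := Num.sqrt (\sum_i (x ord0 i) ^+ 2).

Definition eball (r : R) : set 'rV[R]_d := [set x | enorm x < r].

Definition partial (i : 'I_d) (g : 'rV[R]_d -> R) (x : 'rV[R]_d) : R :=
  'D_(delta_mx ord0 i) g x.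

Definition gradient (g : 'rV[R]_d -> R) (x : 'rV[R]_d) : 'rV[R]_d :=
  \row_i partial i g x.

(* C^k, with all partial derivatives up to order k bounded. *)
Fixpoint Cb (k : nat) (g : 'rV[R]_d -> R) : Prop :=
  [/\ continuous g, exists M, forall x, `|g x| <= M &
      if k is k'.+1 then
        forall i, (forall x, derivable g x (delta_mx ord0 i)) /\
                  Cb k' (partial i g)
      else True].

End euclidean.

Section gibbs.
Context {R : realType} {d : nat}.
Variable V : {mfun 'rV[R]_d >-> R}.

Definition Zpart : R := \int[lebesgue_rV d]_x expR (- V x).

Local Open Scope ereal_scope.

Definition gibbs (A : set 'rV[R]_d) : \bar R :=
  Zpart^-1%:E * \int[lebesgue_rV d]_(x in A) (expR (- V x))%:E.

Let mexpNV : measurable_fun setT (EFin \o (fun x => expR (- V x))).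
Proof.
apply/measurable_EFinP; apply: measurableT_comp => //.
by apply: measurableT_comp.
Qed.

Let expNV_ge0 x : 0 <= (expR (- V x))%:E.
Proof. by rewrite lee_fin expR_ge0. Qed.

Let gibbs0 : gibbs set0 = 0.
Proof. by rewrite /gibbs integral_set0 mule0. Qed.

Let ZpartV_ge0 : (0 <= Zpart^-1)%R.
Proof. by rewrite invr_ge0 fine_ge0// integral_ge0. Qed.

Let gibbs_ge0 A : 0 <= gibbs A.
Proof. by rewrite mule_ge0// integral_ge0. Qed.

Let gibbs_sigma_additive : semi_sigma_additive gibbs.
Proof.
move=> F mF tF mUF.
rewrite /gibbs ge0_integral_bigcup//; last exact: measurable_funTS.
rewrite -nneseriesZl; last by move=> i _; exact: integral_ge0.
apply: is_cvg_ereal_nneg_natsum_cond => n _ _.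
by rewrite mule_ge0// integral_ge0.
Qed.

HB.instance Definition _ := isMeasure.Build _ _ _ gibbs
  gibbs0 gibbs_ge0 gibbs_sigma_additive.

Lemma gibbs_setT :
  \int[lebesgue_rV d]_x (expR (- V x))%:E < +oo -> Zpart != 0%R ->
  gibbs setT = 1.
Proof.
move=> Zoo Z0; rewrite /gibbs -[X in _ * X]fineK.
  by rewrite -EFinM mulVf.
by rewrite ge0_fin_numE// integral_ge0.
Qed.

End gibbs.

Section stable_like.
Context {R : realType} {d : nat}.
Variables (alpha : R) (V : {mfun 'rV[R]_d >-> R}).
Local Open Scope ereal_scope.

Definition stable_form (f g : 'rV[R]_d -> R) : \bar R :=
  \int[gibbs V]_x \int[lebesgue_rV d]_y
    ((f x - f y) * (g x - g y) / enorm (x - y) `^ (d%:R + alpha))%:E.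

Definition form_domain (f : 'rV[R]_d -> R) : Prop :=
  [/\ measurable_fun setT f,
      \int[gibbs V]_x (f x ^+ 2)%:E < +oo &
      stable_form f f < +oo].

Definition weight (x : 'rV[R]_d) : R :=
  (expR (V x) / (1 + enorm x) `^ (d%:R + alpha))%R.

(* The radius of hV and HV is an extended real so that they can be composed
   with PhiV_inv, whose value is +oo on the infimum of the empty set. *)
Definition hV (r : \bar R) : \bar R :=
  ereal_inf [set (expR (V x))%:E | x in [set x | (enorm x)%:E <= r]].

Definition HV (r : \bar R) : \bar R :=
  ereal_sup [set (expR (V x))%:E | x in [set x | (enorm x)%:E <= r]].

Definition PhiV (r : R) : \bar R :=
  ereal_inf [set (weight x)%:E | x in [set x | (r <= enorm x)%R]].

Definition PhiV_inv (r : R) : \bar R :=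
  ereal_inf [set s%:E | s in [set s : R | (0 <= s)%R /\ r%:E <= PhiV s]].

Definition Psi1 (r : R) : \bar R :=
  ereal_sup [set ((1 + enorm x) `^ (d%:R + alpha) / expR (V x))%:E
            | x in [set x | (enorm x <= r)%R]] *
  ereal_sup (range (fun x => (weight x)%:E)).

Definition Psi2 (r : R) : \bar R :=
  (gibbs V (eball r) ^+ 2)^-1 *
  ereal_sup [set \int[lebesgue_rV d]_(y in eball r)
                   (enorm (y - x) `^ (d%:R + alpha) * expR (- 2 * V y))%:E
            | x in eball r].

Definition decay_condition : Prop :=
  let g := fun x : 'rV[R]_d => expR (- V x) in
  limf_esup (fun r : R =>
    (r `^ (d%:R + alpha - 1))%:E *
      ereal_sup [set (enorm (gradient g x))%:E
                | x in [set x | (r - 1 <= enorm x)%R]] +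
    (r `^ (d%:R + alpha - 2))%:E *
      ereal_sup [set (g x)%:E | x in [set x | (r - 1 <= enorm x)%R]])
    (pinfty_nbhs R) = 0.

(* The hypotheses under which beta is used make hV and HV positive real
   numbers at PhiV_inv (c2 / r), so that the powers are the usual ones. *)
Definition beta (c1 c2 r : R) : \bar R :=
  let s := PhiV_inv (c2 / r) in
  let p := (d%:R / alpha)%R in
  c1%:E * (1 + (r `^ (- p))%:E * hV s `^ (- 1 - p) * HV s `^ (2 + p)).

(* In Psi2, e^(-V) stands for the density of gibbs V: Psi2 is multiplied by
   e^(-2k) when V becomes V + k, whereas gibbs V, stable_form and Psi1 do not
   change. The factor Zpart^-2 normalises it, and is 1 when e^(-V) is a
   probability density. *)
Definition betat (c r : R) : \bar R :=
  ereal_inf [set Order.min (c%:E * Psi1 rho) ((Zpart V ^- 2)%:E * Psi2 rho)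
            | rho in [set rho : R |
                (0 < rho)%R /\ gibbs V (~` eball rho) <= (r / (1 + r))%:E]].

Definition poincare (C : R) : Prop :=
  forall f, form_domain f -> \int[gibbs V]_x (f x)%:E = 0 ->
    \int[gibbs V]_x (f x ^+ 2)%:E <= C%:E * stable_form f f.

Definition super_poincare (b : R -> \bar R) : Prop :=
  forall (r : R) f, (0 < r)%R -> form_domain f ->
    \int[gibbs V]_x (f x ^+ 2)%:E <=
    r%:E * stable_form f f + b r * (\int[gibbs V]_x `|f x|%:E) ^+ 2.

Definition weak_poincare (b : R -> \bar R) : Prop :=
  forall (r : R) f, (0 < r)%R -> form_domain f ->
    \int[gibbs V]_x (f x)%:E = 0 ->
    \int[gibbs V]_x (f x ^+ 2)%:E <=
    b r * stable_form f f + r%:E * 'N[gibbs V]_+oo [EFin \o f] ^+ 2.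

End stable_like.

(* Main.v *)
Require Import Defs.
From HB Require Import structures.
From mathcomp Require Import all_boot all_order all_algebra.
From mathcomp Require Import all_classical all_reals all_analysis.
From mathcomp Require Import measurable_realfun ess_sup_inf.
From mathcomp Require Import ring lra.

Set Implicit Arguments.
Unset Strict Implicit.
Unset Printing Implicit Defensive.

Import Order.TTheory GRing.Theory Num.Theory.
Import numFieldNormedType.Exports.

Local Open Scope classical_set_scope.
Local Open Scope ring_scope.

(** Write [g] for [expR (- V)], [p] for [d + alpha] and
    [jump (x, y) = (f x - f y)^2 / |x - y|^p].  Everything is a comparison with
    the form, and the form is used in symmetrised shape: exchanging [x] and [y]
    gives [2 Z E(f, f) = \iint jump (x, y) (g x + g y) dx dy]
    ([stable_form_jump_sym]).  Hence [E] dominates any double integral of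
    [(f x - f y)^2 k (x, y)] whose kernel satisfies
    [|x - y|^p k (x, y) <= K (g x + g y)], and most of the work consists in
    exhibiting such kernels.

    Poincare inequality.  If [V] makes the weight [e^V / (1 + |.|)^p] bounded
    below by [theta > 0], then [g x (1 + |x|)^p <= 1 / theta].  Since [|x - y|]
    is at most twice the larger of [|x|] and [|y|], the kernel [g x g y]
    qualifies on the whole space with [K = 2^p / theta]
    ([stable_form_ge_sqr_diff]), and the double integral of
    [(f x - f y)^2 g x g y] dominates the variance of [f].

    Weak Poincare inequality.  On a ball [B] the same argument uses the supremum
    over [B] of the inverse weight, which gives [Psi1]; applying Cauchy-Schwarz
    to [\int_B (f x - f y) g y dy] with the weight [|x - y|^p] gives [Psi2].
    Passing from [B] to the whole space costs [mu (B^c) / mu B <= r] times the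
    squared sup norm, because a centred [f] has opposite integrals on [B] and on
    [B^c] ([truncated_variance_le]).  In [Psi1] a factor [1 / Z] remains; it is
    absorbed in the supremum of the weight, which bounds [g] from below on a
    fixed cube ([Zpart_inv_le]).

    Super Poincare inequality.  The elementary bound
    [a^2 <= (a - b)^2 + 2 |a| |b|] is integrated over pairs with [x] in a set [A]
    and [y] in a cube attached to [x] ([local_super_poincare]): the first term is
    controlled by the form, and the second one, bounded by a product of
    integrals, by [mu (|f|)^2].  For [|x| <= rho] the cube has side of order
    [t <= 1], lies near [x] inside the ball, and yields a factor [t^alpha] in
    front of the form.  For [|x| > rho] the cube is a fixed one around the origin
    and the factor is the inverse of the infimum of the weight outside the ball.
    With [rho = Phi^-1 (c2 / r)] and [t] of order [r^(1/alpha)] both factors are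
    at most [r / 2]; the constant in front of [mu (|f|)^2] is then of order
    [1 + r^(-d/alpha) H], and [H <= h^(-1-d/alpha) H^(2+d/alpha)] as [h <= H]. *)

(** * Densities, the Cauchy-Schwarz inequality and variances *)

Section density.
Context dp (T : measurableType dp) (R : realType).
Variables (lam nu : {measure set T -> \bar R}) (rho : T -> \bar R).
Hypothesis rho_ge0 : forall x, (0 <= rho x)%E.
Hypothesis rho_fin : forall x, rho x \is a fin_num.
Hypothesis mrho : measurable_fun setT rho.
Hypothesis nuE : forall A, measurable A -> nu A = (\int[lam]_(x in A) rho x)%E.
Local Open Scope ereal_scope.

Import HBNNSimple.

Let density_nnsfun (h : {nnsfun T >-> R}) :
  \int[nu]_x (h x)%:E = \int[lam]_x ((h x)%:E * rho x).
Proof.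
have mterm y : measurable_fun setT (fun x => (y * \1_(h @^-1` [set y]) x)%:E).
  by apply/measurable_EFinP; exact: measurable_funM.
transitivity (\int[nu]_x (\sum_(y \in range h) (y * \1_(h @^-1` [set y]) x)%:E)).
  by apply: eq_integral => t _; rewrite fimfunE -fsumEFin.
rewrite ge0_integral_fsum//; last by move=> y x _; exact: nnfun_muleindic_ge0.
transitivity (\int[lam]_x (\sum_(y \in range h)
    (y * \1_(h @^-1` [set y]) x)%:E * rho x)); last first.
  apply: eq_integral => t _.
  rewrite -ge0_mule_fsuml => [|y]; last exact: nnfun_muleindic_ge0.
  by rewrite fsumEFin // -(fimfunE _ t).
rewrite ge0_integral_fsum//; last 2 first.
  - by move=> y; apply: emeasurable_funM.
  - by move=> y x _; rewrite mule_ge0// nnfun_muleindic_ge0.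
apply: eq_fsbigr => y _.
under eq_integral do rewrite EFinM.
rewrite integralZl_indic_nnsfun//.
under [RHS]eq_integral do rewrite EFinM -muleA.
have [y0|y0] := ltP y 0%R.
  rewrite preimage_nnfun0// integral_indic// set0I measure0 mule0.
  by rewrite integral0_eq// => x _; rewrite indic0 /= mul0e mule0.
rewrite ge0_integralZl//.
- under [in RHS]eq_integral do rewrite muleC.
  rewrite [in RHS](eq_integral (rho \_ (h @^-1` [set y]))); last first.
    by move=> x xE; rewrite epatch_indic.
  by rewrite -integral_mkcond -nuE// integral_indic// setIT.
- by apply: emeasurable_funM => //; exact/measurable_EFinP.
- by move=> x _; rewrite mule_ge0// lee_fin.
Qed.

(** A measure given by a density on sets integrates nonnegative functions with
    that density: this holds for simple functions by linearity, and passes to the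
    limit by monotone convergence. *)
Lemma ge0_integral_density (D : set T) (f : T -> \bar R) : measurable D ->
  (forall x, D x -> 0 <= f x) -> measurable_fun D f ->
  \int[nu]_(x in D) f x = \int[lam]_(x in D) (f x * rho x).
Proof.
move=> mD f0 mf.
rewrite integral_mkcond [RHS]integral_mkcond.
have -> : (fun x => f x * rho x) \_ D = (fun x => (f \_ D) x * rho x).
  by apply/funext => x; rewrite /patch; case: ifP => // _; rewrite mul0e.
have k0 x : 0 <= (f \_ D) x by exact: erestrict_ge0.
have mk : measurable_fun setT (f \_ D) by exact/(measurable_restrictT _ _).1.
set k := f \_ D in k0 mk *.
pose h := nnsfun_approx measurableT mk.
have cvgh x : EFin (h n x) @[n --> \oo] --> k x by exact: cvg_nnsfun_approx.
transitivity (limn (fun n => \int[nu]_x (EFin \o h n) x)).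
  rewrite -monotone_convergence//.
  - by apply: eq_integral => x _; apply/esym/cvg_lim => //; exact: cvgh.
  - by move=> n; exact/measurable_EFinP.
  - by move=> n x _; rewrite lee_fin.
  - by move=> x _ a b ab; rewrite lee_fin; exact/lefP/nd_nnsfun_approx.
transitivity (limn (fun n => \int[lam]_x ((EFin \o h n) x * rho x))).
  by congr (limn _); apply/funext => n; exact: density_nnsfun.
rewrite -monotone_convergence//.
- apply: eq_integral => x _; apply/cvg_lim => //.
  by apply: cvgeZr => //; exact: cvgh.
- by move=> n; apply: emeasurable_funM => //; exact/measurable_EFinP.
- by move=> n x _; rewrite mule_ge0// lee_fin.
- move=> x _ a b ab; rewrite lee_wpmul2r// lee_fin.
  exact/lefP/nd_nnsfun_approx.
Qed.

End density.

Section cauchy_schwarz.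
Context dp (T : measurableType dp) (R : realType).
Variable mu : {measure set T -> \bar R}.
Local Open Scope ereal_scope.

Let cauchy_schwarzT (f g : T -> R) :
  measurable_fun setT f -> measurable_fun setT g ->
  (\int[mu]_x `|f x * g x|%:E) ^+ 2 <=
  (\int[mu]_x (f x ^+ 2)%:E) * (\int[mu]_x (g x ^+ 2)%:E).
Proof.
move=> mf mg.
have two : (2^-1 + 2^-1 = 1 :> R)%R by lra.
have I0 (k : T -> R) : 0 <= \int[mu]_x (k x ^+ 2)%:E.
  by apply: integral_ge0 => x _; rewrite lee_fin sqr_ge0.
have N2 (k : T -> R) : 'N[mu]_2%:E[EFin \o k] = sqrte (\int[mu]_x (k x ^+ 2)%:E).
  rewrite unlock /Lnorm poweR12_sqrt; last first.
    by apply: integral_ge0 => x _; exact: poweR_ge0.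
  congr sqrte; apply: eq_integral => x _ /=.
  by rewrite powR_mulrn// real_normK// num_real.
have := hoelder mu mf mg (ltr0Sn R 1) (ltr0Sn R 1) two.
rewrite Lnorm1 !N2 -lee_sqr ?mule_ge0 ?sqrte_ge0//; last exact: integral_ge0.
by rewrite [leRHS]expe2 muleACA -!expe2 !sqr_sqrte.
Qed.

Lemma cauchy_schwarz_integral (D : set T) (f g : T -> R) : measurable D ->
  measurable_fun D f -> measurable_fun D g ->
  (\int[mu]_(x in D) `|f x * g x|%:E) ^+ 2 <=
  (\int[mu]_(x in D) (f x ^+ 2)%:E) * (\int[mu]_(x in D) (g x ^+ 2)%:E).
Proof.
move=> mD /(measurable_restrictT _ mD).1 mf /(measurable_restrictT _ mD).1 mg.
rewrite !(integral_mkcond D).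
rewrite (_ : (fun x => `|f x * g x|%:E) \_ D =
    (fun x => `|(f \_ D) x * (g \_ D) x|%:E)); last first.
  by apply/funext => x; rewrite /patch; case: ifP; rewrite ?mul0r ?normr0.
have sqr_patch (k : T -> R) :
    (fun x => (k x ^+ 2)%:E) \_ D = (fun x => ((k \_ D) x ^+ 2)%:E).
  by apply/funext => x; rewrite /patch; case: ifP; rewrite ?expr0n.
by rewrite !sqr_patch; exact: cauchy_schwarzT.
Qed.

End cauchy_schwarz.

Section variance.
Context dp (T : measurableType dp) (R : realType).
Variable mu : {measure set T -> \bar R}.
Variables (B : set T) (f : T -> R) (G : T -> \bar R).
Hypotheses (mB : measurable B) (muB : (mu B < +oo)%E).
Hypothesis fint : mu.-integrable B (EFin \o f).
Hypothesis f2int : mu.-integrable B (EFin \o (fun x => f x ^+ 2)).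
Hypothesis mG : measurable_fun B G.
Hypothesis fG : forall x, B x ->
  ((\int[mu]_(y in B) `|f x - f y|%:E) ^+ 2 <= G x)%E.

Let m := fine (mu B).
Let I := \int[mu]_(x in B) f x.
Let J := \int[mu]_(x in B) (f x ^+ 2).

Let cst_int (k : R) : mu.-integrable B (EFin \o cst k).
Proof.
apply: measurable_bounded_integrable => //.
by exists `|k|; split; [exact: num_real|move=> y ky x _ /=; exact: ltW].
Qed.

Let int_cst (k : R) : \int[mu]_(x in B) k = k * m.
Proof. by rewrite Rintegral_cst. Qed.

Let mean_diff x : \int[mu]_(y in B) (f x - f y) = m * f x - I.
Proof.
rewrite RintegralB//; last exact: (cst_int (f x)).
by congr (_ - _); rewrite mulrC -int_cst.
Qed.

Let i1 : mu.-integrable B (EFin \o (fun x => m ^+ 2 * f x ^+ 2)).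
Proof. exact: (integrableZl mB _ f2int). Qed.

Let i2 : mu.-integrable B (EFin \o (fun x => (m * I *+ 2) * f x)).
Proof. exact: (integrableZl mB _ fint). Qed.

Let sqr_dev : \int[mu]_(x in B) ((m * f x - I) ^+ 2) = m ^+ 2 * J - m * I ^+ 2.
Proof.
transitivity (\int[mu]_(x in B) ((m ^+ 2 * f x ^+ 2 - (m * I *+ 2) * f x) + I ^+ 2)).
  by apply: eq_Rintegral => x _; ring.
rewrite (RintegralD mB (integrableB mB i1 i2) (cst_int (I ^+ 2))).
rewrite (RintegralB mB i1 i2) (RintegralZl _ mB f2int) (RintegralZl _ mB fint).
rewrite [X in _ + X](_ : _ = I ^+ 2 * m); last by rewrite -int_cst.
rewrite -/I -/J; ring.
Qed.

(** [m f x - I] is the integral of [f x - f y] over [y] in [B], so [G] bounds its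
    square; the integral of that square over [B] is [m^2 J - m I^2]. *)
Lemma variance_le :
  ((m ^+ 2 * J)%:E <= (m * I ^+ 2)%:E + \int[mu]_(x in B) G x)%E.
Proof.
rewrite -[X in (X <= _)%E](_ : ((m * I ^+ 2)%:E + (m ^+ 2 * J - m * I ^+ 2)%:E = _)%E); last first.
  by rewrite -EFinD addrC subrK.
rewrite leeD2l// -sqr_dev.
have mf : measurable_fun B f by exact/measurable_EFinP/(measurable_int _ fint).
have mdev : measurable_fun B (fun x => (m * f x - I) ^+ 2).
  by apply: measurable_funX; apply: measurable_funB => //; exact: measurable_funM.
have -> : (\int[mu]_(x in B) ((m * f x - I) ^+ 2))%:E =
    (\int[mu]_(x in B) ((m * f x - I) ^+ 2)%:E)%E.
  rewrite /Rintegral fineK//; apply: integrable_fin_num => //.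
  apply: (@eq_integrable _ _ _ _ _ mB
    (EFin \o (fun x => (m ^+ 2 * f x ^+ 2 - (m * I *+ 2) * f x) + I ^+ 2))).
    by move=> x _ /=; congr EFin; ring.
  exact: (integrableD mB (integrableB mB i1 i2) (cst_int (I ^+ 2))).
apply: ge0_le_integral => //.
- by move=> x _; rewrite lee_fin sqr_ge0.
- exact/measurable_EFinP.
move=> x Bx; apply: le_trans (fG Bx).
have int0 : (0 <= \int[mu]_(y in B) `|f x - f y|%:E)%E by exact: integral_ge0.
rewrite -mean_diff -(real_normK (num_real _)) EFin_expe lee_sqr ?lee_fin//.
rewrite EFin_normr_Rintegral//; last exact: (integrableB mB (cst_int (f x)) fint).
apply: le_abse_integral => //; apply/measurable_EFinP.
exact: measurable_funB.
Qed.

End variance.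

Section weak_variance.
Context dp (T : measurableType dp) (R : realType).
Variable mu : {measure set T -> \bar R}.
Variables (f : T -> R) (G : T -> \bar R).
Hypotheses (mu1 : mu setT = 1%E) (mf : measurable_fun setT f).
Hypothesis f2oo : (\int[mu]_x (f x ^+ 2)%:E < +oo)%E.
Hypothesis f_mean0 : (\int[mu]_x (f x)%:E = 0)%E.
Hypothesis mG : measurable_fun setT G.

Lemma sqr_integrable : mu.-integrable setT (EFin \o (fun x => f x ^+ 2)).
Proof.
apply/integrableP; split; first by apply/measurable_EFinP; exact: measurable_funX.
under eq_integral => x _ do rewrite /= ger0_norm ?sqr_ge0//.
exact: f2oo.
Qed.

Lemma sqr_integrable_integrable : mu.-integrable setT (EFin \o f).
Proof.
apply: (@le_integrable _ _ _ _ _ measurableT _ (fun x => (1 + f x ^+ 2)%:E)).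
- exact/measurable_EFinP.
- move=> x _ /=; rewrite lee_fin [leRHS]ger0_norm ?addr_ge0 ?sqr_ge0//.
  by rewrite -(real_normK (num_real (f x))); have := sqr_ge0 (`|f x| - 1); nra.
- have cst1_int : mu.-integrable setT (EFin \o cst (1 : R)).
    apply: measurable_bounded_integrable => //; first by rewrite mu1 ltry.
    by exists 1; split => // y ky x _ /=; rewrite normr1 ltW.
  exact: (integrableD measurableT cst1_int sqr_integrable).
Qed.

Let J0 : (\int[mu]_x (f x ^+ 2))%:E = (\int[mu]_x (f x ^+ 2)%:E)%E.
Proof. by rewrite /Rintegral fineK//; exact: integrable_fin_num sqr_integrable. Qed.

Lemma variance_le_double_integral :
  (forall x, ((\int[mu]_y `|f x - f y|%:E) ^+ 2 <= G x)%E) ->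
  (\int[mu]_x (f x ^+ 2)%:E <= \int[mu]_x G x)%E.
Proof.
move=> fG; have := @variance_le _ _ _ mu setT f G measurableT.
rewrite mu1 ltry => /(_ isT sqr_integrable_integrable sqr_integrable mG).
move=> /(_ (fun x _ => fG x)).
have -> : \int[mu]_x f x = 0 by rewrite /Rintegral f_mean0.
by rewrite /= expr1n mul1r J0 expr0n mulr0 add0e.
Qed.

(** [variance_le] controls [f] on [B] up to the square of its mean there.  As [f]
    is centred, that mean is minus the integral over the complement, of size at
    most [N m'] with [m' = mu (B^c)]; together with [N^2 m'] for the complement
    itself this gives [N^2 (m'^2 / m + m') = N^2 m' / m <= r N^2]. *)
Lemma truncated_variance_le (B : set T) (N r : R) : measurable B ->
  0 < r -> 0 <= N -> (mu (~` B) <= (r / (1 + r))%:E)%E ->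
  {ae mu, forall x, `|f x| <= N} ->
  (forall x, B x -> ((\int[mu]_(y in B) `|f x - f y|%:E) ^+ 2 <= G x)%E) ->
  (\int[mu]_x (f x ^+ 2)%:E <=
   (fine (mu B) ^- 2)%:E * \int[mu]_(x in B) G x + (r * N ^+ 2)%:E)%E.
Proof.
move=> mB r0 N0 muBc fN fG.
have mBc : measurable (~` B) by exact: measurableC.
have le1 A : measurable A -> (mu A <= 1)%E.
  by move=> mA; rewrite -mu1 le_measure// ?inE.
have fin A : measurable A -> (mu A < +oo)%E.
  by move=> mA; apply: le_lt_trans (le1 _ mA) _; rewrite ltry.
have finE A : measurable A -> mu A = (fine (mu A))%:E.
  by move=> mA; rewrite fineK// ge0_fin_numE ?fin.
set m := fine (mu B); set m' := fine (mu (~` B)).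
have mm' : m + m' = 1.
  apply: EFin_inj; rewrite EFinD -!finE// -measureU// ?setUv ?mu1//.
  exact: setICr.
have m'0 : 0 <= m' by exact: fine_ge0.
have m'r : m' * (1 + r) <= r.
  by move: muBc; rewrite finE// lee_fin -/m' ler_pdivlMr// ltr_wpDl.
have m0 : 0 < m by nra.
have disj : [disjoint B & ~` B] by apply/disj_setPS; rewrite setICr.
have intf := sqr_integrable_integrable; have intf2 := sqr_integrable.
have intS A g : measurable A -> mu.-integrable setT g -> mu.-integrable A g.
  by move=> mA; apply: integrableS.
set I := \int[mu]_(x in B) f x; set I' := \int[mu]_(x in ~` B) f x.
have II' : I + I' = 0.
  rewrite /I /I' -Rintegral_setU ?setUv//.
  by rewrite /Rintegral f_mean0.
set J := \int[mu]_(x in B) (f x ^+ 2); set J' := \int[mu]_(x in ~` B) (f x ^+ 2).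
have JJ' : (\int[mu]_x (f x ^+ 2)%:E = (J + J')%:E)%E.
  by rewrite /J /J' -Rintegral_setU ?setUv//.
have I'N : `|I'| <= N * m'.
  rewrite -lee_fin EFin_normr_Rintegral//; last exact: intS.
  apply: le_trans (le_abse_integral _ _ _) _ => //.
    exact/measurable_EFinP/measurable_funTS.
  rewrite EFinM -finE//; apply: integral_le_bound => //.
    exact/measurable_EFinP/measurable_funTS.
  by apply: filterS fN => x fxN _; rewrite lee_fin.
have J'N : J' <= N ^+ 2 * m'.
  apply: le_trans (ler_norm _) _.
  rewrite -lee_fin EFin_normr_Rintegral//; last exact: intS.
  apply: le_trans (le_abse_integral _ _ _) _ => //.
    by apply/measurable_EFinP/measurable_funTS; exact: measurable_funX.
  rewrite EFinM -finE//; apply: integral_le_bound => //.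
      by apply/measurable_EFinP/measurable_funTS; exact: measurable_funX.
    by rewrite lee_fin sqr_ge0.
  by apply: filterS fN => x fxN _; rewrite lee_fin normrX lerXn2r ?nnegrE.
have := @variance_le _ _ _ mu B f G mB (fin _ mB) (intS _ _ mB intf)
  (intS _ _ mB intf2) (measurable_funTS mG) fG.
rewrite -/m -/I -/J JJ'.
have : (0 <= \int[mu]_(x in B) G x)%E.
  by apply: integral_ge0 => x Bx; apply: le_trans (fG _ Bx); rewrite expe_ge0// integral_ge0.
case: (\int[mu]_(x in B) G x)%E => [K K0||]//; last first.
  by rewrite gt0_muley ?leey// lte_fin invr_gt0 exprn_gt0.
rewrite -EFinM -!EFinD !lee_fin => var_le.
have I2 : I ^+ 2 <= (N * m') ^+ 2.
  have -> : I = - I' by lra.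
  by rewrite sqrrN -real_normK ?num_real// lerXn2r ?nnegrE// mulr_ge0.
have J_le : J <= m ^- 2 * K + N ^+ 2 * m' ^+ 2 / m.
  have -> : m ^- 2 * K + N ^+ 2 * m' ^+ 2 / m = (K + m * (N * m') ^+ 2) / m ^+ 2.
    by field; rewrite gt_eqF.
  by rewrite ler_pdivlMr ?exprn_gt0//; nra.
have mr : m' / m <= r by rewrite ler_pdivrMr//; nra.
have -> : r * N ^+ 2 = N ^+ 2 * (m' / m) + N ^+ 2 * (r - m' / m) by ring.
have : N ^+ 2 * m' ^+ 2 / m + N ^+ 2 * m' = N ^+ 2 * (m' / m).
  have -> : m' = 1 - m by lra.
  by field; rewrite gt_eqF.
have : 0 <= N ^+ 2 * (r - m' / m) by rewrite mulr_ge0 ?sqr_ge0// subr_ge0.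
lra.
Qed.

End weak_variance.

(** * The Euclidean norm and Lebesgue measure of cubes *)

Section enorm_theory.
Context {R : realType} {d : nat}.
Implicit Types x y : 'rV[R]_d.

Lemma enorm_ge0 x : 0 <= enorm x.
Proof. exact: sqrtr_ge0. Qed.

Lemma sqr_enorm x : enorm x ^+ 2 = \sum_i x ord0 i ^+ 2.
Proof. by rewrite sqr_sqrtr// sumr_ge0// => i _; exact: sqr_ge0. Qed.

Lemma enorm0 : enorm (0 : 'rV[R]_d) = 0.
Proof.
by rewrite /enorm big1 ?sqrtr0// => i _; rewrite mxE expr0n.
Qed.

Lemma ler_enorm x (r : R) : 0 <= r -> (enorm x <= r) = (\sum_i x ord0 i ^+ 2 <= r ^+ 2).
Proof. by move=> r0; rewrite -sqr_enorm ler_pXn2r ?nnegrE ?enorm_ge0. Qed.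

Lemma coord_le_enorm x i : `|x ord0 i| <= enorm x.
Proof.
rewrite -(ler_pXn2r (ltn0Sn 1)) ?nnegrE ?enorm_ge0// sqr_enorm real_normK ?num_real//.
by rewrite (bigD1 i)//= lerDl sumr_ge0// => j _; exact: sqr_ge0.
Qed.

Lemma enorm_le_coord x (s : R) : (forall i, `|x ord0 i| <= s) -> enorm x <= d%:R * s.
Proof.
have [d0 _|d0 xs] := posnP d.
  rewrite ler_enorm ?big1 ?sqr_ge0 ?d0 ?mul0r// => i.
  by have := ltn_ord i; rewrite [X in (_ < X)%N]d0.
have s0 : 0 <= s by exact: le_trans (normr_ge0 _) (xs (Ordinal d0)).
rewrite ler_enorm ?mulr_ge0//.
apply: (@le_trans _ _ (\sum_(i < d) s ^+ 2)).
  apply: ler_sum => i _; rewrite -real_normK ?num_real//.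
  by rewrite ler_pXn2r ?nnegrE.
rewrite sumr_const card_ord -[_ *+ d]mulr_natl exprMn ler_wpM2r ?sqr_ge0//.
by rewrite expr2 ler_peMr// ler1n.
Qed.

(** A quasi-triangle inequality, which costs only powers of 2 in the constants and
    follows coordinatewise from [(a - b)^2 <= 2 a^2 + 2 b^2]. *)
Lemma enormB_le x y : enorm (x - y) <= 2 * Num.max (enorm x) (enorm y).
Proof.
set M := Num.max _ _.
have M0 : 0 <= M by rewrite le_max enorm_ge0.
have sx : \sum_i x ord0 i ^+ 2 <= M ^+ 2 by rewrite -ler_enorm// le_max lexx.
have sy : \sum_i y ord0 i ^+ 2 <= M ^+ 2 by rewrite -ler_enorm// le_max lexx orbT.
rewrite ler_enorm ?mulr_ge0//.
apply: (@le_trans _ _ (\sum_i (2 * x ord0 i ^+ 2 + 2 * y ord0 i ^+ 2))).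
  by apply: ler_sum => i _; rewrite !mxE; have := sqr_ge0 (x ord0 i + y ord0 i); nra.
rewrite big_split/= -!mulr_sumr; nra.
Qed.

Lemma enormN x : enorm (- x) = enorm x.
Proof. by congr Num.sqrt; apply: eq_bigr => i _; rewrite mxE sqrrN. Qed.

Lemma enormBC x y : enorm (x - y) = enorm (y - x).
Proof. by rewrite -enormN opprB. Qed.

Lemma enorm_eq0 x : enorm x = 0 -> x = 0.
Proof.
move=> x0; apply/rowP => i; rewrite mxE; apply/eqP; rewrite -normr_le0.
by rewrite -x0 coord_le_enorm.
Qed.

Lemma measurable_enorm : measurable_fun setT (@enorm R d).
Proof.
apply: (measurableT_comp (continuous_measurable_fun (@sqrt_continuous R))).
by apply: measurable_sum => i; apply: measurable_funX; exact: measurable_rV_coord.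
Qed.

Lemma measurable_rVB : measurable_fun setT (fun z : 'rV[R]_d * 'rV[R]_d => z.1 - z.2).
Proof.
apply: measurable_rVP => i.
rewrite (_ : (fun _ => _) = (fun z : 'rV[R]_d * 'rV[R]_d => z.1 ord0 i - z.2 ord0 i)); last first.
  by apply/funext => z; rewrite !mxE.
by apply: measurable_funB; apply: measurableT_comp (measurable_rV_coord i) _.
Qed.

End enorm_theory.

Section cube.
Context {R : realType}.

(** Closed sup-norm ball of radius [s] centred at [c]: unlike Euclidean balls, its
    measure follows from the construction of Lebesgue measure as an iterated
    product. *)
Definition cube (d : nat) (c : 'I_d -> R) (s : R) : set 'rV[R]_d :=
  [set y | forall i, `|y ord0 i - c i| <= s].

Lemma measurable_forall_ord d (T : measurableType d) (n : nat) (A : 'I_n -> set T) :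
  (forall i, measurable (A i)) -> measurable [set x | forall i, A i x].
Proof.
move=> mA; have -> : [set x | forall i, A i x] = \bigcap_i A i.
  by apply/seteqP; split => x H i; [move=> _; exact: H|exact: H].
by apply: fin_bigcap_measurable.
Qed.

Lemma measurable_cube (d : nat) (c : 'I_d -> R) (s : R) : measurable (cube c s).
Proof.
apply: measurable_forall_ord => i.
rewrite -[X in measurable X]setTI; apply: measurable_fun_le => //.
apply: measurableT_comp => //; apply: measurable_funB => //.
exact: measurable_rV_coord.
Qed.

Lemma lebesgue_cube (d : nat) (c : 'I_d -> R) (s : R) : 0 <= s ->
  lebesgue_rV d (cube c s) = (((2 * s) ^+ d)%:E)%E.
Proof.
move=> s0; elim: d c => [|d IH] c.
  rewrite /= expr0 diracE mem_set//.
  by move=> [].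
transitivity ((lebesgue_measure \x lebesgue_rV d)%E
   (`[c ord0 - s, c ord0 + s]%classic `*` cube (fun i => c (lift ord0 i)) s)).
  rewrite /= /lebesgue_rV_cons /pushforward; congr (_ _).
  apply/seteqP; split => [[t y]/= H|[t y]/= [H1 H2] i].
    split => /=.
      have := H ord0; rewrite mxE unlift_none/= in_itv/=.
      by rewrite ler_distl.
    by move=> i; have := H (lift ord0 i); rewrite mxE liftK.
  rewrite mxE; case: (unliftP ord0 i) => [j|] -> //=.
  by rewrite ler_distl; move: H1; rewrite in_itv.
rewrite product_measure1E//; last exact: measurable_cube.
rewrite [X in (X * _)%E]lebesgue_measure_itv/= lte_fin IH exprS EFinM; congr (_ * _)%E.
case: ltP => [_|]; first by rewrite -EFinD; congr EFin; ring.
move=> s_le0; have -> : s = 0 by apply/eqP; rewrite eq_le s0 andbT; lra.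
by rewrite mulr0.
Qed.

End cube.

(** * The Gibbs measure and the symmetrised form *)

Section gibbs_theory.
Context {R : realType} {d : nat}.
Variable V : {mfun 'rV[R]_d >-> R}.
Local Notation lam := (lebesgue_rV d).
Local Notation g x := (expR (- V x)).
Local Notation Z := (Zpart V).
Hypothesis Zoo : (\int[lam]_x (g x)%:E < +oo)%E.

Lemma measurable_expNV : measurable_fun setT (fun x => g x).
Proof. by apply: measurableT_comp => //; exact: measurableT_comp. Qed.

Lemma integral_expNV_gt0 : (0 < \int[lam]_x (g x)%:E)%E.
Proof.
rewrite lt0e integral_ge0 ?andbT//.
apply/eqP => I0.
have mg : measurable_fun setT (EFin \o (fun x => g x)).
  by apply/measurable_EFinP; exact: measurable_expNV.
have /(ae_eq_integral_abs lam measurableT mg) [N [mN N0 subN]] :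
    (\int[lam]_x `|(g x)%:E| = 0)%E.
  by rewrite -[RHS]I0; apply: eq_integral => x _; rewrite gee0_abs// lee_fin expR_ge0.
have cubeN : cube (fun=> 0) 1 `<=` N.
  move=> x _; apply: subN => /= /(_ Logic.I) [] /eqP.
  by rewrite gt_eqF ?expR_gt0.
have : (lam (cube (fun=> 0%R) 1%R) <= lam N)%E.
  by apply: le_measure => //; rewrite inE//; exact: measurable_cube.
rewrite N0 lebesgue_cube// lee_fin leNgt exprn_gt0//.
Qed.

Lemma integral_expNVE : (\int[lam]_x (g x)%:E)%E = Z%:E.
Proof. by rewrite /Zpart /Rintegral fineK// gt0_fin_numE ?integral_expNV_gt0. Qed.

Lemma Zpart_gt0 : 0 < Z.
Proof. by rewrite -lte_fin -integral_expNVE integral_expNV_gt0. Qed.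

Lemma gibbs_setT1 : gibbs V setT = 1%E.
Proof. by apply: gibbs_setT => //; rewrite gt_eqF// Zpart_gt0. Qed.

(** Multiplying by [Z] keeps the density free of the normalising constant. *)
Lemma integral_gibbs (D : set 'rV[R]_d) (f : 'rV[R]_d -> \bar R) : measurable D ->
  (forall x, 0 <= f x)%E -> measurable_fun D f ->
  (Z%:E * \int[gibbs V]_(x in D) f x = \int[lam]_(x in D) (f x * (g x)%:E))%E.
Proof.
move=> mD f0 mf.
have mg : measurable_fun setT (EFin \o (fun x => g x)).
  by apply/measurable_EFinP; exact: measurable_expNV.
have Z0 := Zpart_gt0.
rewrite (@ge0_integral_density _ _ _ lam _ (fun x => (Z^-1 * g x)%:E)) //; last 3 first.
- by move=> x; rewrite lee_fin mulr_ge0 ?invr_ge0 ?expR_ge0// ltW.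
- by apply/measurable_EFinP; apply: measurable_funM => //; exact: measurable_expNV.
- move=> A mA; rewrite /= /gibbs -ge0_integralZl//.
  + exact: measurable_funTS.
  + by rewrite lee_fin invr_ge0 ltW.
rewrite -ge0_integralZl ?lee_fin ?ltW//.
- apply: eq_integral => x _; rewrite EFinM muleCA; congr (_ * _)%E.
  by rewrite -!EFinM mulrA divff ?mul1r// gt_eqF.
- apply: emeasurable_funM => //; apply: measurable_funTS.
  by apply/measurable_EFinP; apply: measurable_funM => //; exact: measurable_expNV.
- by move=> x _; rewrite mule_ge0// lee_fin mulr_ge0 ?invr_ge0 ?expR_ge0// ltW.
Qed.

Lemma integral_gibbs_sqr (D : set 'rV[R]_d) (f : 'rV[R]_d -> R) : measurable D ->
  measurable_fun setT f ->
  (Z%:E * \int[gibbs V]_(x in D) (f x ^+ 2)%:E = \int[lam]_(x in D) (f x ^+ 2 * g x)%:E)%E.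
Proof.
move=> mD mf; rewrite integral_gibbs//.
  by move=> x; rewrite lee_fin sqr_ge0.
by apply/measurable_EFinP/measurable_funTS; exact: measurable_funX.
Qed.

Section jump.
Variables (alpha : R) (f : 'rV[R]_d -> R).
Hypothesis mf : measurable_fun setT f.
Local Notation p := (d%:R + alpha).

(** Its value on the diagonal is 0, the inverse of 0 being 0 here. *)
Definition jump (z : 'rV[R]_d * 'rV[R]_d) : R :=
  (f z.1 - f z.2) ^+ 2 / enorm (z.1 - z.2) `^ p.

Lemma jump_ge0 z : 0 <= jump z.
Proof. by rewrite divr_ge0 ?sqr_ge0// powR_ge0. Qed.

Lemma jumpC x y : jump (x, y) = jump (y, x).
Proof. by rewrite /jump/= enormBC -sqrrN opprB. Qed.

(** On the diagonal both sides vanish. *)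
Lemma jump_mul z : (f z.1 - f z.2) ^+ 2 = jump z * enorm (z.1 - z.2) `^ p.
Proof.
have [z0|z0] := eqVneq (enorm (z.1 - z.2)) 0.
  have /eqP := enorm_eq0 z0; rewrite subr_eq0 => /eqP E.
  by rewrite /jump E !subrr expr0n /= !mul0r.
by rewrite /jump mulfVK// powR_eq0 negb_and z0.
Qed.

Let mf1 : measurable_fun setT (fun z : 'rV[R]_d * 'rV[R]_d => f z.1).
Proof. exact: measurableT_comp. Qed.

Let mf2 : measurable_fun setT (fun z : 'rV[R]_d * 'rV[R]_d => f z.2).
Proof. exact: measurableT_comp. Qed.

Let mg1 : measurable_fun setT (fun z : 'rV[R]_d * 'rV[R]_d => g z.1).
Proof. exact: (measurableT_comp measurable_expNV). Qed.

Let mg2 : measurable_fun setT (fun z : 'rV[R]_d * 'rV[R]_d => g z.2).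
Proof. exact: (measurableT_comp measurable_expNV). Qed.

Lemma measurable_jump : measurable_fun setT jump.
Proof.
rewrite (_ : jump = fun z => (f z.1 - f z.2) ^+ 2 * enorm (z.1 - z.2) `^ (- p)); last first.
  by apply/funext => z; rewrite powRN.
apply: measurable_funM; first by apply: measurable_funX; exact: measurable_funB.
apply: (measurableT_comp (measurable_powR _)).
exact: (measurableT_comp measurable_enorm measurable_rVB).
Qed.

Let mj1 : measurable_fun setT (fun z => (jump z * g z.1)%:E).
Proof. by apply/measurable_EFinP; apply: measurable_funM => //; exact: measurable_jump. Qed.

Let mj2 : measurable_fun setT (fun z => (jump z * g z.2)%:E).
Proof. by apply/measurable_EFinP; apply: measurable_funM => //; exact: measurable_jump. Qed.

Let mg_ge0 (h : 'rV[R]_d * 'rV[R]_d -> 'rV[R]_d) z : (0 <= (jump z * g (h z))%:E)%E.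
Proof. by rewrite lee_fin mulr_ge0 ?jump_ge0 ?expR_ge0. Qed.

Lemma stable_form_ge0 : (0 <= stable_form alpha V f f)%E.
Proof.
apply: integral_ge0 => x _; apply: integral_ge0 => y _.
by rewrite lee_fin divr_ge0 ?powR_ge0// -expr2 sqr_ge0.
Qed.

Lemma stable_form_jump : (Z%:E * stable_form alpha V f f =
  \int[lam \x lam]_z (jump z * g z.1)%:E)%E.
Proof.
rewrite integral_gibbs//; last 2 first.
- move=> x; apply: integral_ge0 => y _.
  by rewrite lee_fin divr_ge0 ?powR_ge0// -expr2 sqr_ge0.
- apply: (measurable_fun_fubini_tonelli_F (fun z => (jump z)%:E)).
  + by apply/measurable_EFinP; exact: measurable_jump.
  + by move=> z; rewrite lee_fin jump_ge0.
rewrite (fubini_tonelli1 (fun z => (jump z * g z.1)%:E) mj1 (mg_ge0 fst)).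
apply: eq_integral => x _; rewrite /fubini_F/=.
have mjx : measurable_fun setT (fun y => (jump (x, y))%:E).
  apply/measurable_EFinP; apply: (measurableT_comp measurable_jump).
  exact: measurable_pair1.
rewrite -ge0_integralZr ?lee_fin ?expR_ge0//.
- by move=> y _; exact: (jump_ge0 (x, y)).
Qed.

(** The form integrates [jump] against [dy mu(dx)]; [jump] is symmetric, so by
    Tonelli it may as well be integrated against [dx mu(dy)]. *)
Lemma stable_form_jump_sym : ((2 * Z)%:E * stable_form alpha V f f =
  \int[lam \x lam]_z (jump z * (g z.1 + g z.2))%:E)%E.
Proof.
under [RHS]eq_integral do rewrite mulrDr EFinD.
rewrite ge0_integralD//.
rewrite [X in (_ + X)%E](_ : _ = \int[lam \x lam]_z (jump z * g z.1)%:E)%E; last first.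
  rewrite (fubini_tonelli2 _ mj2 (mg_ge0 snd)) (fubini_tonelli1 _ mj1 (mg_ge0 fst)).
  apply: eq_integral => y _; rewrite /fubini_F /fubini_G/=.
  by apply: eq_integral => x _; rewrite jumpC.
have Z0 := ltW Zpart_gt0.
by rewrite -stable_form_jump -ge0_muleDl ?lee_fin// -EFinD mulr2n mulrDl mul1r.
Qed.

End jump.
End gibbs_theory.

(** * A local super Poincare inequality *)

Section comparison.
Context {R : realType} {d : nat}.
Variable V : {mfun 'rV[R]_d >-> R}.
Local Notation lam := (lebesgue_rV d).
Local Notation g x := (expR (- V x)).
Local Notation Z := (Zpart V).
Hypothesis Zoo : (\int[lam]_x (g x)%:E < +oo)%E.
Variables (alpha : R) (f : 'rV[R]_d -> R).
Hypothesis mf : measurable_fun setT f.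
Local Notation p := (d%:R + alpha).
Local Notation jump := (jump alpha f).
Local Notation E := (stable_form alpha V f f).

Lemma integral_absE : (Z%:E * \int[gibbs V]_x `|f x|%:E =
  \int[lam]_x (`|f x| * g x)%:E)%E.
Proof.
rewrite integral_gibbs//.
by apply/measurable_EFinP; exact: measurableT_comp.
Qed.

Lemma integral_abs_tensor :
  (\int[lam]_x \int[lam]_y (`|f x| * g x * (`|f y| * g y))%:E =
   (Z%:E * \int[gibbs V]_x `|f x|%:E) ^+ 2)%E.
Proof.
have mfg : measurable_fun setT (fun x => (`|f x| * g x)%:E).
  apply/measurable_EFinP; apply: measurable_funM; first exact: measurableT_comp.
  exact: measurable_expNV.
have fg0 x : (0 <= (`|f x| * g x)%:E)%E by rewrite lee_fin mulr_ge0 ?expR_ge0.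
rewrite integral_absE expe2.
under eq_integral => x _.
  under eq_integral do rewrite EFinM.
  rewrite ge0_integralZl//.
  over.
rewrite ge0_integralZr//.
exact: integral_ge0.
Qed.

(** The bound [(f x)^2 <= (f x - f y)^2 + 2 |f x| |f y|] is integrated against
    [g x] over [x] in [A] and [y] in the cube attached to [x].  The left-hand side
    gains the volume of the cube.  By the first half of the assumption
    [(f x - f y)^2 g x] is at most [K jump (x, y) (g x + g y)]; by the second
    half the factor [1 <= H g y] may be inserted in the product term, which then
    integrates to the square of [Z mu (|f|)]. *)
Lemma local_super_poincare (A : set 'rV[R]_d) (kappa s K H : R) :
  measurable A -> 0 <= s -> 0 <= K -> 0 <= H ->
  (forall x y, A x -> cube (fun i => kappa * x ord0 i) s y ->
     g x * enorm (x - y) `^ p <= K * (g x + g y) /\ 1 <= H * g y) ->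
  (((2 * s) ^+ d)%:E * \int[gibbs V]_(x in A) (f x ^+ 2)%:E <=
   (2 * K)%:E * E + (2 * H * Z)%:E * (\int[gibbs V]_x `|f x|%:E) ^+ 2)%E.
Proof.
move=> mA s0 K0 H0 hD.
have Z0 := Zpart_gt0 Zoo.
rewrite -(@lee_pmul2l _ Z%:E)// muleCA integral_gibbs_sqr//.
pose jg z := jump z * (g z.1 + g z.2).
pose ff (z : 'rV[R]_d * 'rV[R]_d) := `|f z.1| * g z.1 * (`|f z.2| * g z.2).
have mg : measurable_fun setT (fun x => g x) by exact: measurable_expNV.
have mg1 : measurable_fun setT (fun z : 'rV[R]_d * 'rV[R]_d => g z.1).
  exact: (measurableT_comp mg).
have mg2 : measurable_fun setT (fun z : 'rV[R]_d * 'rV[R]_d => g z.2).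
  exact: (measurableT_comp mg).
have mf1 : measurable_fun setT (fun z : 'rV[R]_d * 'rV[R]_d => `|f z.1|).
  by apply: measurableT_comp => //; exact: measurableT_comp.
have mf2 : measurable_fun setT (fun z : 'rV[R]_d * 'rV[R]_d => `|f z.2|).
  by apply: measurableT_comp => //; exact: measurableT_comp.
have mjg : measurable_fun setT jg.
  by apply: measurable_funM; [exact: measurable_jump|exact: measurable_funD].
have mff : measurable_fun setT ff.
  by apply: measurable_funM; exact: measurable_funM.
have jg0 z : 0 <= jg z by rewrite mulr_ge0 ?jump_ge0// addr_ge0// expR_ge0.
have ff0 z : 0 <= ff z by rewrite !mulr_ge0// expR_ge0.
pose u z := K * jg z + 2 * H * ff z.
have mu : measurable_fun setT (EFin \o u).
  by apply/measurable_EFinP; apply: measurable_funD; exact: measurable_funM.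
have u0 z : (0 <= (EFin \o u) z)%E by rewrite lee_fin addr_ge0// mulr_ge0// mulr_ge0.
have -> : (Z%:E * ((2 * K)%:E * E + (2 * H * Z)%:E * (\int[gibbs V]_x `|f x|%:E) ^+ 2) =
    \int[lam]_x \int[lam]_y (u (x, y))%:E)%E.
  rewrite -(fubini_tonelli1 (EFin \o u) mu u0).
  transitivity (\int[lam \x lam]_z (K%:E * (jg z)%:E + (2 * H)%:E * (ff z)%:E))%E; last first.
    by apply: eq_integral => z _; rewrite /u /= -!EFinM -EFinD.
  rewrite ge0_integralD//; last 4 first.
  - by move=> z _; rewrite -EFinM lee_fin mulr_ge0.
  - by apply: measurable_funeM; apply/measurable_EFinP.
  - by move=> z _; rewrite -EFinM lee_fin !mulr_ge0.
  - by apply: measurable_funeM; apply/measurable_EFinP.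
  rewrite !ge0_integralZl ?lee_fin ?mulr_ge0//;
    try exact/measurable_EFinP; try by move=> z _; rewrite lee_fin.
  rewrite /jg -stable_form_jump_sym// (fubini_tonelli1 (EFin \o ff)); last 2 first.
  - exact/measurable_EFinP.
  - by move=> z; rewrite lee_fin.
  rewrite integral_abs_tensor.
  have b0 : (0 <= \int[gibbs V]_x `|f x|%:E)%E by exact: integral_ge0.
  rewrite ge0_muleDr ?mule_ge0 ?expe_ge0 ?stable_form_ge0 ?lee_fin ?mulr_ge0 ?(ltW Z0)//.
  congr (_ + _)%E; first by rewrite !muleA -!EFinM; congr (_%:E * _)%E; ring.
  rewrite !expe2 muleACA !muleA -!EFinM; congr (_%:E * _ * _)%E; ring.
have mF : measurable_fun setT (fun x => \int[lam]_y (u (x, y))%:E)%E.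
  exact: (measurable_fun_fubini_tonelli_F _ mu u0).
have F0 x : (0 <= \int[lam]_y (u (x, y))%:E)%E.
  by apply: integral_ge0 => y _; exact: u0.
have mfg : measurable_fun setT (fun x => (f x ^+ 2 * g x)%:E).
  apply/measurable_EFinP; apply: measurable_funM => //; exact: measurable_funX.
have fg0 x : 0 <= f x ^+ 2 * g x by rewrite mulr_ge0 ?sqr_ge0 ?expR_ge0.
have q0 : 0 <= (2 * s) ^+ d by rewrite exprn_ge0// mulr_ge0.
rewrite -ge0_integralZl ?lee_fin//; [|exact: measurable_funTS|by move=> x _; rewrite lee_fin].
apply: (@le_trans _ _ (\int[lam]_(x in A) \int[lam]_y (u (x, y))%:E))%E; last first.
  exact: ge0_subset_integral.
apply: ge0_le_integral => //.
- by move=> x _; rewrite -EFinM lee_fin mulr_ge0.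
- by apply: measurable_funTS; exact: measurable_funeM.
- exact: measurable_funTS.
move=> x Ax; set C := cube (fun i => kappa * x ord0 i) s.
have mC : measurable C by exact: measurable_cube.
have -> : (((2 * s) ^+ d)%:E * (f x ^+ 2 * g x)%:E =
    \int[lam]_(y in C) (f x ^+ 2 * g x)%:E)%E.
  by rewrite integral_cst// muleC; congr (_ * _)%E; exact/esym/lebesgue_cube.
have mux : measurable_fun setT (fun y => (u (x, y))%:E).
  by apply: (measurableT_comp mu); exact: pair1_measurable.
apply: (@le_trans _ _ (\int[lam]_(y in C) (u (x, y))%:E))%E; last first.
  apply: ge0_subset_integral => //; move=> y _; exact: u0.
apply: ge0_le_integral => //.
- by move=> y _; rewrite lee_fin.
- exact: measurable_funTS.
move=> y Cy; have [hK hH] := hD _ _ Ax Cy.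
rewrite lee_fin /u /jg /ff/=.
have gx0 := expR_ge0 (- V x); have gy0 := expR_ge0 (- V y).
have j0 := jump_ge0 alpha f (x, y).
have jE := jump_mul alpha f (x, y).
have jK : (f x - f y) ^+ 2 * g x <= K * (jump (x, y) * (g x + g y)).
  by rewrite jE/= -mulrA [leRHS]mulrCA ler_wpM2l// mulrC.
have xyH : `|f x| * `|f y| * g x * 1 <= `|f x| * `|f y| * g x * (H * g y).
  by rewrite ler_wpM2l// !mulr_ge0.
have sq : f x ^+ 2 <= (f x - f y) ^+ 2 + 2 * (`|f x| * `|f y|).
  have := ler_norm (f x * f y); rewrite normrM; have := sqr_ge0 (f y); nra.
have := ler_wpM2r gx0 sq; rewrite /=; nra.
Qed.

End comparison.

(** * Deviations from the mean *)

Section mean_deviation.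
Context {R : realType} {d : nat}.
Variable V : {mfun 'rV[R]_d >-> R}.
Local Notation lam := (lebesgue_rV d).
Local Notation g x := (expR (- V x)).
Local Notation Z := (Zpart V).
Hypothesis Zoo : (\int[lam]_x (g x)%:E < +oo)%E.
Variables (alpha : R) (f : 'rV[R]_d -> R).
Hypothesis alpha_gt0 : 0 < alpha.
Hypothesis mf : measurable_fun setT f.
Local Notation p := (d%:R + alpha).
Local Notation jump := (jump alpha f).
Local Notation E := (stable_form alpha V f f).

Lemma measurable_integral_snd (B : set 'rV[R]_d) (u : 'rV[R]_d * 'rV[R]_d -> R) :
  measurable B -> measurable_fun setT u -> (forall z, 0 <= u z) ->
  measurable_fun setT (fun x => \int[lam]_(y in B) (u (x, y))%:E)%E.
Proof.
move=> mB mu u0.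
pose v z : \bar R := (u z * \1_(setT `*` B) z)%:E.
have mv : measurable_fun setT v.
  apply/measurable_EFinP; apply: measurable_funM => //.
  by apply: measurable_indic; exact: measurableX.
have v0 z : (0 <= v z)%E by rewrite lee_fin mulr_ge0.
have -> : (fun x => \int[lam]_(y in B) (u (x, y))%:E)%E = fubini_F lam v.
  apply/funext => x; rewrite integral_mkcond /fubini_F.
  apply: eq_integral => y _; rewrite /v /patch indicE in_setX in_setT/=.
  by case: (y \in B); rewrite ?mulr1 ?mulr0.
exact: measurable_fun_fubini_tonelli_F.
Qed.

Let msq : measurable_fun setT (fun z : 'rV[R]_d * 'rV[R]_d => (f z.1 - f z.2) ^+ 2).
Proof.
by apply: measurable_funX; apply: measurable_funB; exact: measurableT_comp.
Qed.

Let mg1 : measurable_fun setT (fun z : 'rV[R]_d * 'rV[R]_d => g z.1).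
Proof. exact: (measurableT_comp (measurable_expNV V)). Qed.

Let mg2 : measurable_fun setT (fun z : 'rV[R]_d * 'rV[R]_d => g z.2).
Proof. exact: (measurableT_comp (measurable_expNV V)). Qed.

Let mfx x : measurable_fun setT (fun y => f x - f y).
Proof. exact: measurable_funB. Qed.

Lemma integral_gibbs_sqr_diff (B : set 'rV[R]_d) x : measurable B ->
  (\int[gibbs V]_(y in B) ((f x - f y) ^+ 2)%:E =
   (Z^-1)%:E * \int[lam]_(y in B) ((f x - f y) ^+ 2 * g y)%:E)%E.
Proof.
move=> mB; rewrite -integral_gibbs_sqr// muleA -EFinM mulVf ?mul1e//.
by rewrite gt_eqF// Zpart_gt0.
Qed.

Lemma measurable_sqr_diff (B : set 'rV[R]_d) : measurable B ->
  measurable_fun setT (fun x => \int[gibbs V]_(y in B) ((f x - f y) ^+ 2)%:E)%E.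
Proof.
move=> mB; under eq_fun do rewrite integral_gibbs_sqr_diff//.
apply: measurable_funeM.
apply: (@measurable_integral_snd B (fun z => (f z.1 - f z.2) ^+ 2 * g z.2)) => //.
  exact: measurable_funM.
by move=> z; rewrite mulr_ge0 ?sqr_ge0 ?expR_ge0.
Qed.

Lemma double_gibbs_sqr_diff (B : set 'rV[R]_d) : measurable B ->
  ((Z ^+ 2)%:E * \int[gibbs V]_(x in B) \int[gibbs V]_(y in B) ((f x - f y) ^+ 2)%:E =
   \int[lam]_(x in B) \int[lam]_(y in B) ((f x - f y) ^+ 2 * g x * g y)%:E)%E.
Proof.
move=> mB; have Z0 := Zpart_gt0 Zoo.
rewrite EFin_expe expe2 -muleA integral_gibbs//; last 2 first.
- by move=> x; apply: integral_ge0 => y _; rewrite lee_fin sqr_ge0.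
- by apply: measurable_funTS; exact: measurable_sqr_diff.
rewrite -ge0_integralZl ?lee_fin ?(ltW Z0)//; last 2 first.
- apply: measurable_funTS; apply: emeasurable_funM; first exact: measurable_sqr_diff.
  by apply/measurable_EFinP; exact: measurable_expNV.
- move=> x _; rewrite mule_ge0 ?lee_fin ?expR_ge0//.
  by apply: integral_ge0 => y _; rewrite lee_fin sqr_ge0.
apply: eq_integral => x _; rewrite muleA integral_gibbs_sqr//.
rewrite -ge0_integralZr ?lee_fin ?expR_ge0//; last 2 first.
- apply/measurable_EFinP/measurable_funTS; apply: measurable_funM; first exact: measurable_funX.
  exact: measurable_expNV.
- by move=> y _; rewrite lee_fin mulr_ge0 ?sqr_ge0 ?expR_ge0.
by apply: eq_integral => y _; rewrite -EFinM mulrAC.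
Qed.

(** If [|x|] is the larger norm, [|x - y|^p g x <= (2 (1 + |x|))^p g x <= 2^p S],
    so [|x - y|^p g x g y <= 2^p S (g x + g y)], and likewise if [|y|] is. *)
Lemma stable_form_ge_sqr_diff (B : set 'rV[R]_d) (S : R) : measurable B ->
  0 <= S -> (forall x, B x -> g x * (1 + enorm x) `^ p <= S) ->
  (Z%:E * \int[gibbs V]_(x in B) \int[gibbs V]_(y in B) ((f x - f y) ^+ 2)%:E <=
   (2 * (2 `^ p * S))%:E * E)%E.
Proof.
move=> mB S0 gS; have Z0 := Zpart_gt0 Zoo.
have p0 : 0 <= p by rewrite addr_ge0// ltW.
rewrite -(@lee_pmul2l _ Z%:E)// muleA -EFinM -expr2 double_gibbs_sqr_diff//.
have -> : (Z%:E * ((2 * (2 `^ p * S))%:E * E) = (2 `^ p * S)%:E * ((2 * Z)%:E * E))%E.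
  by rewrite !muleA -!EFinM; congr (_%:E * _)%E; ring.
have c0 : 0 <= 2 `^ p * S by rewrite mulr_ge0 ?powR_ge0.
rewrite stable_form_jump_sym//.
pose u z := jump z * (g z.1 + g z.2).
have mu : measurable_fun setT u.
  by apply: measurable_funM; [exact: measurable_jump|exact: measurable_funD].
have u0 z : 0 <= u z by rewrite mulr_ge0 ?jump_ge0// addr_ge0// expR_ge0.
rewrite -ge0_integralZl ?lee_fin//; last 2 first.
- exact/measurable_EFinP.
- by move=> z _; exact: u0.
under [leRHS]eq_integral do rewrite -EFinM.
pose w z : \bar R := (2 `^ p * S * u z)%:E.
have mw : measurable_fun setT w.
  by apply/measurable_EFinP; exact: measurable_funM.
have w0 z : (0 <= w z)%E by rewrite lee_fin mulr_ge0.
rewrite (fubini_tonelli1 w mw w0).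
have mF : measurable_fun setT (fubini_F lam w) by exact: measurable_fun_fubini_tonelli_F.
apply: (@le_trans _ _ (\int[lam]_(x in B) fubini_F lam w x))%E; last first.
  apply: ge0_subset_integral => // x _.
  by apply: integral_ge0 => y _; exact: w0.
apply: ge0_le_integral => //.
- move=> x _; apply: integral_ge0 => y _.
  by rewrite lee_fin mulr_ge0 ?expR_ge0// mulr_ge0 ?sqr_ge0 ?expR_ge0.
- apply: measurable_funTS.
  apply: (@measurable_integral_snd B (fun z => (f z.1 - f z.2) ^+ 2 * g z.1 * g z.2)) => //.
    by apply: measurable_funM => //; exact: measurable_funM.
  by move=> z; rewrite mulr_ge0 ?expR_ge0// mulr_ge0 ?sqr_ge0 ?expR_ge0.
- exact: measurable_funTS.
move=> x Bx; rewrite /fubini_F.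
have mwx : measurable_fun setT (fun y => w (x, y)).
  by apply: (measurableT_comp mw); exact: pair1_measurable.
apply: (@le_trans _ _ (\int[lam]_(y in B) w (x, y)))%E; last first.
  by apply: ge0_subset_integral => // y _; exact: w0.
apply: ge0_le_integral => //.
- by move=> y _; rewrite lee_fin mulr_ge0 ?expR_ge0// mulr_ge0 ?sqr_ge0 ?expR_ge0.
- apply/measurable_EFinP/measurable_funTS.
  apply: measurable_funM; last exact: measurable_expNV.
  by apply: measurable_funM => //; exact: measurable_funX.
- exact: measurable_funTS.
move=> y By; rewrite lee_fin /u/= (jump_mul alpha f (x, y))/=.
have gx0 := expR_ge0 (- V x); have gy0 := expR_ge0 (- V y).
suff eK : enorm (x - y) `^ p * (g x * g y) <= 2 `^ p * S * (g x + g y).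
  have := ler_wpM2l (jump_ge0 alpha f (x, y)) eK; lra.
have e1 (t : 'rV[R]_d) : enorm (x - y) <= 2 * enorm t -> B t ->
    enorm (x - y) `^ p * g t <= 2 `^ p * S.
  move=> xyt Bt; apply: (@le_trans _ _ ((2 * (1 + enorm t)) `^ p * g t)).
    rewrite ler_wpM2r ?expR_ge0//; apply: ge0_ler_powR => //.
    - by rewrite nnegrE enorm_ge0.
    - by rewrite nnegrE mulr_ge0 ?addr_ge0 ?enorm_ge0.
    by apply: le_trans xyt _; rewrite ler_wpM2l// lerDr.
  rewrite powRM ?addr_ge0 ?enorm_ge0// -mulrA ler_wpM2l ?powR_ge0// mulrC.
  exact: gS.
have := enormB_le x y; rewrite maxEle; case: ifP => _ /e1.
  move=> /(_ By) h; have := ler_wpM2r gx0 h; have := mulr_ge0 c0 gy0; nra.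
move=> /(_ Bx) h; have := ler_wpM2r gy0 h; have := mulr_ge0 c0 gx0; nra.
Qed.

(** Needed because the constants of the weak Poincare inequality may be infinite,
    in which case their product with a vanishing form is 0. *)
Lemma stable_form_eq0 : E = 0%E ->
  (\int[gibbs V]_x \int[gibbs V]_y ((f x - f y) ^+ 2)%:E = 0)%E.
Proof.
move=> E0; have Z0 := Zpart_gt0 Zoo.
pose w z := (f z.1 - f z.2) ^+ 2 * g z.1 * g z.2.
have mw : measurable_fun setT (EFin \o w).
  by apply/measurable_EFinP; apply: measurable_funM => //; exact: measurable_funM.
have w0 z : (0 <= (EFin \o w) z)%E.
  by rewrite lee_fin mulr_ge0 ?expR_ge0// mulr_ge0 ?sqr_ge0 ?expR_ge0.
have mj : measurable_fun setT (fun z => (jump z * g z.1)%:E).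
  by apply/measurable_EFinP; apply: measurable_funM => //; exact: measurable_jump.
have : (\int[lam \x lam]_z `|(jump z * g z.1)%:E| = 0)%E.
  rewrite -[RHS](mule0 Z%:E) -E0 stable_form_jump//; apply: eq_integral => z _.
  by rewrite gee0_abs// lee_fin mulr_ge0 ?jump_ge0 ?expR_ge0.
move/(ae_eq_integral_abs _ measurableT mj) => jump_ae0.
have : (\int[lam \x lam]_z `|(EFin \o w) z| = 0)%E.
  apply/(ae_eq_integral_abs _ measurableT mw).
  apply: filterS jump_ae0 => z /(_ Logic.I) [] jz0 _; congr EFin.
  by rewrite /w (jump_mul alpha f z) (mulrAC (jump z)) jz0 !mul0r.
have -> : (\int[lam \x lam]_z `|(EFin \o w) z| = \int[lam \x lam]_z (EFin \o w) z)%E.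
  by apply: eq_integral => z _; rewrite gee0_abs.
rewrite (fubini_tonelli1 _ mw w0) -double_gibbs_sqr_diff// => /eqP.
by rewrite mule_eq0 eqe expf_eq0/= gt_eqF//= => /eqP.
Qed.

Lemma integral_jump_le (B : set 'rV[R]_d) : measurable B ->
  (\int[gibbs V]_(x in B) \int[lam]_(y in B) (jump (x, y))%:E <= E)%E.
Proof.
move=> mB.
have mjx x : measurable_fun setT (fun y => (jump (x, y))%:E).
  apply/measurable_EFinP; apply: (measurableT_comp (measurable_jump alpha mf)).
  exact: pair1_measurable.
have mj A : measurable A ->
    measurable_fun setT (fun x => \int[lam]_(y in A) (jump (x, y))%:E)%E.
  move=> mA; apply: measurable_integral_snd => //; first exact: measurable_jump.
  by move=> z; exact: jump_ge0.
have j0 x y : (0 <= (jump (x, y))%:E)%E by rewrite lee_fin jump_ge0.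
apply: (@le_trans _ _ (\int[gibbs V]_(x in B) \int[lam]_y (jump (x, y))%:E))%E.
  apply: ge0_le_integral => //.
  - by move=> x _; exact: integral_ge0.
  - by apply: measurable_funTS; exact: mj.
  - by apply: measurable_funTS; exact: mj.
  - by move=> x _; exact: ge0_subset_integral.
apply: ge0_subset_integral => //; first exact: mj.
by move=> x _; exact: integral_ge0.
Qed.

(** Cauchy-Schwarz for the factorisation of [(f x - f y) g y] as the product of
    [|x - y|^(p/2) g y] and [(f x - f y) |x - y|^(-p/2)]. *)
Lemma weighted_mean_diff_le (B : set 'rV[R]_d) (x : 'rV[R]_d) : measurable B ->
  ((\int[gibbs V]_(y in B) `|f x - f y|%:E) ^+ 2 <=
   (Z ^- 2)%:E * ((\int[lam]_(y in B) (enorm (y - x) `^ p * expR (- 2 * V y))%:E) *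
     \int[lam]_(y in B) (jump (x, y))%:E))%E.
Proof.
move=> mB; have Z0 := Zpart_gt0 Zoo.
have mexy : measurable_fun setT (fun y : 'rV[R]_d => enorm (x - y)).
  exact: (measurableT_comp (measurableT_comp measurable_enorm measurable_rVB)
    (pair1_measurable x)).
pose a (y : 'rV[R]_d) : R := enorm (x - y) `^ (p / 2) * g y.
pose b (y : 'rV[R]_d) : R := (f x - f y) * enorm (x - y) `^ (- (p / 2)).
have -> : (\int[gibbs V]_(y in B) `|f x - f y|%:E =
    (Z^-1)%:E * \int[lam]_(y in B) `|a y * b y|%:E)%E.
  rewrite -[LHS]mul1e -(@mulVf _ Z) ?gt_eqF// EFinM -muleA; congr (_ * _)%E.
  rewrite integral_gibbs//; last first.
    by apply/measurable_EFinP/measurable_funTS; exact: measurableT_comp.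
  apply: eq_integral => y _; rewrite -EFinM; congr EFin.
  rewrite /a /b !normrM !(ger0_norm (powR_ge0 _ _)) (ger0_norm (expR_ge0 _)).
  have [xy0|xy0] := eqVneq (enorm (x - y)) 0.
    by have /eqP := enorm_eq0 xy0; rewrite subr_eq0 => /eqP ->; rewrite !subrr normr0 !(mul0r,mulr0).
  by rewrite powRN; field; rewrite powR_eq0 negb_and xy0.
rewrite !expe2 muleACA -EFinM -invfM -expr2 -expe2.
apply: lee_pmul => //; first by rewrite lee_fin invr_ge0 sqr_ge0.
- exact/expe_ge0/integral_ge0.
have mpow r : measurable_fun setT (fun y : 'rV[R]_d => enorm (x - y) `^ r).
  exact: (measurableT_comp (measurable_powR _)).
apply: le_trans (cauchy_schwarz_integral _ _ _ _) _ => //.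
- by apply: measurable_funTS; apply: measurable_funM => //; exact: measurable_expNV.
- by apply: measurable_funTS; apply: measurable_funM.
apply: lee_pmul.
- by apply: integral_ge0 => y _; rewrite lee_fin sqr_ge0.
- by apply: integral_ge0 => y _; rewrite lee_fin sqr_ge0.
- rewrite le_eqVlt; apply/orP; left; apply/eqP; apply: eq_integral => y _; congr EFin.
  rewrite /a exprMn -(powR_mulrn 2 (powR_ge0 _ _)) -powRrM mulfVK// enormBC; congr (_ * _).
  by rewrite expr2 -expRD; congr expR; ring.
- rewrite le_eqVlt; apply/orP; left; apply/eqP; apply: eq_integral => y _; congr EFin.
  by rewrite /b exprMn -(powR_mulrn 2 (powR_ge0 _ _)) -powRrM mulNr mulfVK// powRN.
Qed.

End mean_deviation.

(** * Poincare inequalities by direct comparison *)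

Section weight_bounds.
Context {R : realType} {d : nat}.
Variables (alpha : R) (V : {mfun 'rV[R]_d >-> R}).
Local Notation lam := (lebesgue_rV d).
Local Notation g x := (expR (- V x)).
Local Notation Z := (Zpart V).
Local Notation p := (d%:R + alpha).

Lemma one_plus_enorm_gt0 (x : 'rV[R]_d) : 0 < 1 + enorm x.
Proof. by rewrite ltr_pwDl// enorm_ge0. Qed.

Lemma weight_gt0 x : 0 < weight alpha V x.
Proof. by rewrite divr_gt0 ?expR_gt0// powR_gt0// one_plus_enorm_gt0. Qed.

Lemma weightV x : (weight alpha V x)^-1 = g x * (1 + enorm x) `^ p.
Proof. by rewrite /weight invf_div mulrC -expRN. Qed.

(** A bounded weight bounds [g] from below where [|x| <= 1], in particular on the
    cube of half-side [1 / d], of volume [(2 / d)^d]. *)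
Lemma Zpart_inv_le (W : R) : (0 < d)%N -> 0 < alpha <= 2 ->
  (\int[lam]_x (g x)%:E < +oo)%E -> (forall x, weight alpha V x <= W) ->
  Z^-1 <= 4 * d%:R ^+ d * W.
Proof.
move=> d0 /andP[alpha0 alpha2] Zoo wW; have Z0 := Zpart_gt0 Zoo.
have dR : 0 < d%:R :> R by rewrite ltr0n.
have W0 : 0 < W by exact: lt_le_trans (weight_gt0 0) (wW 0).
have K0 : 0 < W * 2 ^+ d.+2 by rewrite mulr_gt0// exprn_gt0.
have gW (x : 'rV[R]_d) : cube (fun=> 0) d%:R^-1 x -> (W * 2 ^+ d.+2)^-1 <= g x.
  move=> xc; have x1 : enorm x <= 1.
    rewrite -(divff (lt0r_neq0 dR)); apply: enorm_le_coord => i.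
    by rewrite -[x ord0 i]subr0.
  rewrite -[g x]invrK lef_pV2 ?posrE ?invr_gt0 ?expR_gt0// -expRN opprK.
  have := wW x; rewrite /weight ler_pdivrMr ?powR_gt0 ?one_plus_enorm_gt0// => /le_trans; apply.
  rewrite ler_wpM2l ?(ltW W0)// -powR_mulrn//.
  apply: (@le_trans _ _ (2 `^ p)).
  - apply: ge0_ler_powR; rewrite ?nnegrE//.
    + by rewrite addr_ge0// ltW.
    + exact/ltW/one_plus_enorm_gt0.
    + by rewrite -[2%R]/(1 + 1) lerD2l.
  - by rewrite ler_powR ?ler1n// -addn2 natrD lerD2l.
suff : (((2 * d%:R^-1) ^+ d)%:E * ((W * 2 ^+ d.+2)^-1)%:E <= Z%:E)%E.
  rewrite -EFinM lee_fin => le_Z.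
  rewrite invf_ple ?posrE ?mulr_gt0 ?exprn_gt0//; apply: le_trans le_Z.
  rewrite le_eqVlt; apply/orP; left; apply/eqP; rewrite exprMn exprVn !exprS.
  by field; rewrite !gt_eqF ?exprn_gt0.
rewrite -integral_expNVE// -(lebesgue_cube (fun=> 0)) ?invr_ge0//.
rewrite muleC -integral_cst; last exact: measurable_cube.
apply: (@le_trans _ _ (\int[lam]_(x in cube (fun=> 0%R) d%:R^-1) (g x)%:E))%E.
  apply: ge0_le_integral => //.
  - exact: measurable_cube.
  - by move=> x _; rewrite lee_fin invr_ge0 ltW.
  - apply: measurable_funTS; apply/measurable_EFinP; exact: measurable_expNV.
apply: ge0_subset_integral => //.
- exact: measurable_cube.
- by apply/measurable_EFinP; exact: measurable_expNV.
Qed.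

End weight_bounds.

Section poincare_inequalities.
Context {R : realType} {d : nat}.
Variables (alpha : R) (V : {mfun 'rV[R]_d >-> R}).
Local Notation lam := (lebesgue_rV d).
Local Notation g x := (expR (- V x)).
Local Notation Z := (Zpart V).
Local Notation p := (d%:R + alpha).
Hypothesis alpha_gt0 : 0 < alpha.
Hypothesis Zoo : (\int[lam]_x (g x)%:E < +oo)%E.

Lemma mean_diff_le_sqr (f : 'rV[R]_d -> R) (B : set 'rV[R]_d) x : measurable_fun setT f ->
  measurable B ->
  ((\int[gibbs V]_(y in B) `|f x - f y|%:E) ^+ 2 <=
   gibbs V B * \int[gibbs V]_(y in B) ((f x - f y) ^+ 2)%:E)%E.
Proof.
move=> mf mB.
have mfx : measurable_fun B (fun y => f x - f y).
  by apply: measurable_funTS; exact: measurable_funB.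
have := cauchy_schwarz_integral (gibbs V) mB mfx (measurable_cst (1 : R)).
have -> : (\int[gibbs V]_(y in B) (cst (1 : R) y ^+ 2)%:E = gibbs V B)%E.
  under eq_integral do rewrite /= expr1n.
  by rewrite integral_cst// mul1e.
by under eq_integral do rewrite mulr1; rewrite muleC.
Qed.

Lemma poincare_of_weight_ge (theta : R) : 0 < theta ->
  (forall x, theta <= weight alpha V x) ->
  poincare alpha V (2 * (2 `^ p * theta^-1) / Z).
Proof.
move=> theta0 wtheta f [mf f2oo Eoo] f0; have Z0 := Zpart_gt0 Zoo.
apply: (@le_trans _ _ (\int[gibbs V]_x \int[gibbs V]_y ((f x - f y) ^+ 2)%:E)%E).
  apply: variance_le_double_integral => //; first exact: gibbs_setT1.
    exact: measurable_sqr_diff.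
  move=> x; apply: le_trans (mean_diff_le_sqr _ mf measurableT) _.
  by rewrite gibbs_setT1// mul1e.
rewrite -(@lee_pmul2l _ Z%:E)// muleA -EFinM mulrCA divff ?gt_eqF// mulr1.
apply: stable_form_ge_sqr_diff => //; first by rewrite invr_ge0 ltW.
by move=> x _; rewrite -weightV lef_pV2 ?posrE// weight_gt0.
Qed.

Lemma measurable_eball (r : R) : measurable (@eball R d r).
Proof.
have := @measurable_enorm R d measurableT _ (measurable_itv `]-oo, r[).
by rewrite setTI (_ : _ @^-1` _ = eball r)//; apply/seteqP; split => x /=; rewrite in_itv.
Qed.

Lemma gibbs_fineE (A : set 'rV[R]_d) : measurable A ->
  gibbs V A = (fine (gibbs V A))%:E.
Proof.
move=> mA; rewrite fineK// ge0_fin_numE// (@le_lt_trans _ _ 1%E) ?ltry//.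
by rewrite -(gibbs_setT1 Zoo) le_measure// ?inE.
Qed.

Lemma gibbs_ge_of_setC_le (A : set 'rV[R]_d) (r : R) : measurable A -> 0 < r ->
  (gibbs V (~` A) <= (r / (1 + r))%:E)%E -> ((1 + r)^-1%:E <= gibbs V A)%E.
Proof.
move=> mA r0 Ar.
have r1 : 0 < 1 + r by rewrite ltr_wpDl.
have mAc : measurable (~` A) by exact: measurableC.
have : (gibbs V A + gibbs V (~` A) = 1)%E.
  rewrite -measureU//; last by rewrite setICr.
  by rewrite setUv; exact: gibbs_setT1.
move: Ar; rewrite (gibbs_fineE mA) (gibbs_fineE mAc) !lee_fin => Ar [] AAc.
have -> : (1 + r)^-1 = 1 - r / (1 + r) by field; rewrite gt_eqF.
lra.
Qed.

Section weak.
Variables (f : 'rV[R]_d -> R) (r N rho : R).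
Hypothesis fD : form_domain alpha V f.
Hypothesis f0 : (\int[gibbs V]_x (f x)%:E = 0)%E.
Hypotheses (r0 : 0 < r) (N0 : 0 <= N) (rho0 : 0 < rho).
Hypothesis fN : {ae gibbs V, forall x, `|f x| <= N}.
Hypothesis rhor : (gibbs V (~` eball rho) <= (r / (1 + r))%:E)%E.
Local Notation E := (stable_form alpha V f f).
Local Notation B := (@eball R d rho).

Let mf : measurable_fun setT f. Proof. by case: fD. Qed.
Let f2oo : (\int[gibbs V]_x (f x ^+ 2)%:E < +oo)%E. Proof. by case: fD. Qed.
Let mB : measurable B. Proof. exact: measurable_eball. Qed.

Let muB_ge : ((1 + r)^-1%:E <= gibbs V B)%E.
Proof. exact: gibbs_ge_of_setC_le. Qed.

Let muB_fin : gibbs V B = (fine (gibbs V B))%:E.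
Proof. exact: gibbs_fineE. Qed.

Let m_gt0 : 0 < fine (gibbs V B).
Proof.
rewrite -lte_fin -muB_fin; apply: lt_le_trans muB_ge.
by rewrite lte_fin invr_gt0 ltr_wpDl// ltW.
Qed.

Lemma weak_poincare_Psi2 :
  (\int[gibbs V]_x (f x ^+ 2)%:E <=
   (Z ^- 2)%:E * Psi2 alpha V rho * E + (r * N ^+ 2)%:E)%E.
Proof.
have m0 := m_gt0; set m := fine (gibbs V B) in m0 *.
rewrite /Psi2; set s := ereal_sup _.
have sup_ge x : B x -> (\int[lam]_(y in B)
    (enorm (y - x) `^ p * expR (- 2 * V y))%:E <= s)%E.
  by move=> Bx; apply: ereal_sup_ubound; exists x.
have s0 : (0 <= s)%E.
  apply: le_trans (sup_ge 0 _); last by rewrite /eball/= enorm0.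
  by apply: integral_ge0 => y _; rewrite lee_fin mulr_ge0 ?powR_ge0 ?expR_ge0.
pose j x := (\int[lam]_(y in B) (jump alpha f (x, y))%:E)%E.
have j0 x : (0 <= j x)%E by apply: integral_ge0 => y _; rewrite lee_fin jump_ge0.
have mj : measurable_fun setT j.
  apply: measurable_integral_snd => //; first exact: measurable_jump.
  exact: jump_ge0.
pose G x := ((Z ^- 2)%:E * (s * j x))%E.
have mG : measurable_fun setT G by do 2 apply: measurable_funeM.
have Z20 : 0 <= Z ^- 2 by rewrite invr_ge0 sqr_ge0.
have fG x : B x -> ((\int[gibbs V]_(y in B) `|f x - f y|%:E) ^+ 2 <= G x)%E.
  move=> Bx; apply: le_trans (weighted_mean_diff_le Zoo alpha mf x mB) _.
  apply: lee_wpmul2l; first by rewrite lee_fin.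
  by apply: lee_wpmul2r; [exact: j0|exact: sup_ge].
have := truncated_variance_le (gibbs_setT1 Zoo) mf f2oo f0 mG mB r0 N0 rhor fN fG.
move=> /le_trans; apply; apply: leeD2r.
rewrite muB_fin -/m -EFin_expe inver gt_eqF ?exprn_gt0//.
rewrite muleCA -!muleA; apply: lee_wpmul2l; first by rewrite lee_fin invr_ge0 sqr_ge0.
rewrite ge0_integralZl ?lee_fin//; last 2 first.
- by apply: measurable_funTS; exact: measurable_funeM.
- by move=> x _; rewrite mule_ge0.
apply: lee_wpmul2l; first by rewrite lee_fin.
rewrite ge0_integralZl//; last exact: measurable_funTS.
by apply: lee_wpmul2l => //; exact: integral_jump_le.
Qed.

(** For [r >= 1] the term [r N^2] alone suffices.  For [r < 1] the ball has mass at
    least [1 / 2], which bounds the factor [1 / mu B] that comes from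
    normalising on the ball.  If [Psi1] is infinite, so is its product with the
    nonzero form. *)
Lemma weak_poincare_Psi1 : (0 < d)%N -> alpha <= 2 -> E != 0%E ->
  (\int[gibbs V]_x (f x ^+ 2)%:E <=
   (16 * d%:R ^+ d * 2 ^+ d.+2)%:E * Psi1 alpha V rho * E + (r * N ^+ 2)%:E)%E.
Proof.
move=> d0 alpha2 E0; have Z0 := Zpart_gt0 Zoo.
have c0 : 0 < 16 * d%:R ^+ d * 2 ^+ d.+2 :> R.
  by rewrite mulr_gt0 ?exprn_gt0// mulr_gt0 ?exprn_gt0 ?ltr0n.
have Egt0 : (0 < E)%E by rewrite lt0e E0 stable_form_ge0.
set c := 16 * _ in c0 *.
rewrite /Psi1; set S := ereal_sup _; set W := ereal_sup _.
have Sge x : enorm x <= rho -> ((g x * (1 + enorm x) `^ p)%:E <= S)%E.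
  by move=> xr; apply: ereal_sup_ubound; exists x => //; rewrite -weightV /weight invf_div.
have Wge x : ((weight alpha V x)%:E <= W)%E by apply: ereal_sup_ubound; exists x.
have Sgt0 : (0 < S)%E.
  apply: lt_le_trans (Sge 0 _); last by rewrite enorm0 ltW.
  by rewrite lte_fin mulr_gt0 ?expR_gt0// powR_gt0// one_plus_enorm_gt0.
have Wgt0 : (0 < W)%E by apply: lt_le_trans (Wge 0); rewrite lte_fin weight_gt0.
have [r1|r1] := leP 1 r.
  have fN2 : (\int[gibbs V]_x (f x ^+ 2)%:E <= (N ^+ 2)%:E)%E.
    rewrite -[leRHS]mule1 -(gibbs_setT1 Zoo).
    under eq_integral do rewrite -[(_ ^+ 2)%:E]gee0_abs ?lee_fin ?sqr_ge0//.
    apply: integral_le_bound => //; rewrite ?lee_fin ?sqr_ge0//.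
      by apply/measurable_EFinP; exact: measurable_funX.
    apply: filterS fN => x fxN _.
    by rewrite lee_fin normrX lerXn2r ?nnegrE.
  apply: le_trans fN2 _; rewrite -[leLHS]add0e; apply: leeD.
    by rewrite mule_ge0 ?(ltW Egt0)// mule_ge0 ?lee_fin ?(ltW c0)// mule_ge0 ?ltW.
  by rewrite lee_fin ler_peMl ?sqr_ge0.
have [SWoo|] := eqVneq (S * W)%E +oo%E.
  by rewrite SWoo gt0_muley ?lte_fin// gt0_mulye// addye// leey.
case: S Sge Sgt0 => [S||] Sge Sgt0 //; last by rewrite gt0_mulye// eqxx.
case: W Wge Wgt0 => [W||] Wge Wgt0 //; last by rewrite gt0_muley// eqxx.
rewrite !lte_fin in Sgt0 Wgt0; move=> _.
have m0 := m_gt0; set m := fine (gibbs V B) in m0 *.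
pose k x := (\int[gibbs V]_(y in B) ((f x - f y) ^+ 2)%:E)%E.
have k0 x : (0 <= k x)%E by apply: integral_ge0 => y _; rewrite lee_fin sqr_ge0.
have mk : measurable_fun setT k by exact: measurable_sqr_diff.
pose G x := (gibbs V B * k x)%E.
have mG : measurable_fun setT G by exact: measurable_funeM.
have fG x : B x -> ((\int[gibbs V]_(y in B) `|f x - f y|%:E) ^+ 2 <= G x)%E.
  by move=> Bx; exact: mean_diff_le_sqr.
have := truncated_variance_le (gibbs_setT1 Zoo) mf f2oo f0 mG mB r0 N0 rhor fN fG.
move=> /le_trans; apply; apply: leeD2r.
rewrite -/m /G muB_fin -/m ge0_integralZl//; last 2 first.
- exact: measurable_funTS.
- by rewrite lee_fin ltW.
have gS x : B x -> g x * (1 + enorm x) `^ p <= S.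
  by move=> Bx; rewrite -lee_fin; apply: Sge; exact: ltW.
have := stable_form_ge_sqr_diff Zoo alpha_gt0 mf mB (ltW Sgt0) gS.
set I := (\int[gibbs V]_(x in B) k x)%E => ZI.
have -> : ((m ^- 2)%:E * (m%:E * I) = (m^-1 * Z^-1)%:E * (Z%:E * I))%E.
  by rewrite !muleA -!EFinM; congr (_%:E * _)%E; field; rewrite !gt_eqF.
have mZ0 : 0 <= m^-1 * Z^-1 by rewrite mulr_ge0 ?invr_ge0 ?ltW.
apply: le_trans (lee_wpmul2l _ ZI) _; first by rewrite lee_fin.
rewrite muleA -!EFinM; apply: lee_wpmul2r; first exact: ltW.
rewrite lee_fin /c.
have m2 : m^-1 <= 2.
  have : (1 + r)^-1 <= m by rewrite -lee_fin -muB_fin.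
  rewrite -invf_ple ?posrE ?ltr_wpDl//; lra.
have ZW : Z^-1 <= 4 * d%:R ^+ d * W.
  by apply: (@Zpart_inv_le _ _ alpha) => //; rewrite alpha_gt0.
have p2 : 2 `^ p <= 2 ^+ d.+2.
  by rewrite -powR_mulrn// ler_powR ?ler1n// -addn2 natrD lerD2l.
have -> : 16 * d%:R ^+ d * 2 ^+ d.+2 * (S * W) =
    2 * (4 * d%:R ^+ d * W) * (2 * (2 ^+ d.+2 * S)) by ring.
have Z'0 : 0 <= Z^-1 by rewrite invr_ge0 ltW.
have m'0 : 0 <= m^-1 by rewrite invr_ge0 ltW.
apply: ler_pM => //.
- by rewrite mulr_ge0// mulr_ge0 ?powR_ge0// ltW.
- exact: ler_pM.
- by rewrite ler_wpM2l// ler_wpM2r// ltW.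
Qed.

End weak.
End poincare_inequalities.

(** * The weak Poincare inequality *)

Section weak_poincare_betat.
Context {R : realType} {d : nat}.
Variables (alpha : R) (V : {mfun 'rV[R]_d >-> R}).
Local Notation lam := (lebesgue_rV d).
Local Notation g x := (expR (- V x)).
Local Notation Z := (Zpart V).
Local Notation p := (d%:R + alpha).
Hypothesis d_gt0 : (0 < d)%N.
Hypothesis alpha_gt0 : 0 < alpha.
Hypothesis Zoo : (\int[lam]_x (g x)%:E < +oo)%E.

Lemma Psi1_ge0 rho : 0 < rho -> (0 <= Psi1 alpha V rho)%E.
Proof.
move=> rho0; apply: mule_ge0.
  apply: (@le_trans _ _ ((1 + enorm (0 : 'rV[R]_d)) `^ p / expR (V 0))%:E).
    by rewrite lee_fin divr_ge0 ?powR_ge0 ?expR_ge0.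
  by apply: ereal_sup_ubound; exists 0; rewrite //= enorm0 ltW.
apply: (@le_trans _ _ (weight alpha V 0)%:E); first by rewrite lee_fin ltW// weight_gt0.
by apply: ereal_sup_ubound; exists 0.
Qed.

Lemma Psi2_ge0 rho : 0 < rho -> (0 <= Psi2 alpha V rho)%E.
Proof.
move=> r0; apply: mule_ge0.
  by rewrite inve_ge0 expe_ge0.
apply: (@le_trans _ _ (\int[lam]_(y in @eball R d rho)
    (enorm (y - 0) `^ p * expR (- 2 * V y))%:E)%E).
  by apply: integral_ge0 => y _; rewrite lee_fin mulr_ge0 ?powR_ge0 ?expR_ge0.
by apply: ereal_sup_ubound; exists 0 => //; rewrite /eball/= enorm0.
Qed.

Lemma Lnorm_infty_bound (f : 'rV[R]_d -> R) (N : R) :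
  ('N[gibbs V]_+oo [EFin \o f])%E = N%:E -> {ae gibbs V, forall x, `|f x| <= N}.
Proof.
rewrite unlock /Lnorm [X in (0 < X)%E](_ : _ = 1%E); last exact: gibbs_setT1.
rewrite lte01 => supN.
have := ess_sup_ge (gibbs V) (abse \o (EFin \o f)); rewrite supN.
by apply: filterS => x /=; rewrite lee_fin.
Qed.

(** Passing to the infimum over the radius divides by the form, which must then be
    positive; when it vanishes [f] is almost everywhere constant, hence 0. *)
Lemma weak_poincare_betat : alpha <= 2 ->
  weak_poincare alpha V (betat alpha V (16 * d%:R ^+ d * 2 ^+ d.+2)).
Proof.
move=> alpha2 r f r0 fD f0; set c := 16 * d%:R ^+ d * 2 ^+ d.+2.
have c0 : 0 < c.
  by rewrite /c mulr_gt0 ?exprn_gt0// mulr_gt0 ?exprn_gt0 ?ltr0n.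
have [mf f2oo Eoo] := fD.
have Z0 := Zpart_gt0 Zoo.
have N0 := Lnorm_ge0 (gibbs V) +oo%E (EFin \o f).
have b0 : (0 <= betat alpha V c r)%E.
  apply: le_ereal_inf_tmp => _ [rho [rho0 _] <-].
  rewrite le_min mule_ge0 ?lee_fin ?(ltW c0) ?Psi1_ge0//=.
  by rewrite mule_ge0 ?Psi2_ge0// lee_fin invr_ge0 sqr_ge0.
have E0 := stable_form_ge0 V alpha f.
have [Ez|Ez] := eqVneq (stable_form alpha V f f) 0%E.
  have -> : (\int[gibbs V]_x (f x ^+ 2)%:E = 0)%E.
    apply/eqP; rewrite eq_le; apply/andP; split; last first.
      by apply: integral_ge0 => x _; rewrite lee_fin sqr_ge0.
    rewrite -(stable_form_eq0 Zoo mf Ez).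
    apply: variance_le_double_integral => //; first exact: gibbs_setT1.
      exact: measurable_sqr_diff.
    move=> x; apply: le_trans (mean_diff_le_sqr V _ mf measurableT) _.
    by rewrite gibbs_setT1// mul1e.
  by rewrite Ez mule0 add0e mule_ge0 ?expe_ge0// lee_fin ltW.
case NE : ('N[gibbs V]_+oo [EFin \o f])%E N0 => [N||] // N0; last first.
  have -> : (r%:E * +oo ^+ 2 = +oo)%E by rewrite expe2 mulyy gt0_muley ?lte_fin.
  by rewrite addey ?leey// gt_eqF// (lt_le_trans ltNy0)// mule_ge0.
have fN := Lnorm_infty_bound NE.
rewrite -EFin_expe -EFinM.
have e0 : (0 < stable_form alpha V f f)%E by rewrite lt0e Ez.
case EE : (stable_form alpha V f f) e0 Eoo => [e||] // e0 _.
rewrite lte_fin in e0.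
have f2fin : (\int[gibbs V]_x (f x ^+ 2)%:E)%E \is a fin_num.
  by rewrite ge0_fin_numE// integral_ge0// => x _; rewrite lee_fin sqr_ge0.
rewrite -leeBlDr// -lee_pdivrMr//.
apply: le_ereal_inf_tmp => _ [rho [rho0 rhor] <-].
rewrite lee_pdivrMr// leeBlDr// -EE.
rewrite minEle; case: ifP => _.
  by apply: weak_poincare_Psi1 => //.
by apply: weak_poincare_Psi2 => //.
Qed.

Lemma tail_small (r : R) : 0 < r ->
  exists rho : R, 0 < rho /\ (gibbs V (~` eball rho) <= r%:E)%E.
Proof.
move=> r0.
pose F n := ~` (@eball R d n%:R).
have mF n : measurable (F n) by apply: measurableC; exact: measurable_eball.
have F0oo : (gibbs V (F 0%N) < +oo)%E by rewrite (gibbs_fineE Zoo (mF 0%N)) ltry.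
have cvgF : gibbs V (F n) @[n --> \oo] --> gibbs V (\bigcap_n F n).
  apply: nonincreasing_cvg_mu => //.
  - exact: bigcap_measurable.
  - apply/nonincreasing_seqP => n; apply/subsetPset => x /=.
    rewrite /F /eball/= => /negP; rewrite -leNgt => xn; apply/negP; rewrite -leNgt.
    by apply: le_trans xn; rewrite ler_nat.
have F0 : \bigcap_n F n = set0.
  apply/seteqP; split => // x /(_ (Num.truncn (enorm x)).+1 Logic.I).
  by rewrite /F /eball/=; apply; exact: truncnS_gt.
rewrite F0 measure0 in cvgF.
have : \forall n \near \oo, (gibbs V (F n) < r%:E)%E.
  have re0 : (0 < r%:E)%E by rewrite lte_fin.
  exact: (cvgF _ (open_ereal_lt' re0)).
move=> [n _ nP]; exists n.+1%:R; split => //.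
by apply/ltW/nP => /=.
Qed.

Lemma betat_lty (c r : R) : 0 < r ->
  (forall rho : R,
    (\int[lam]_(x in @eball R d rho) (expR (- 2 * V x))%:E < +oo)%E) ->
  (betat alpha V c r < +oo)%E.
Proof.
move=> r0 V2oo.
have q0 : 0 < r / (1 + r) by rewrite divr_gt0// addr_gt0.
have [rho [rho0 rhor]] := tail_small q0.
apply: (@le_lt_trans _ _ (Order.min (c%:E * Psi1 alpha V rho) ((Z ^- 2)%:E * Psi2 alpha V rho)))%E.
  by apply: ereal_inf_lbound; exists rho.
rewrite gt_min; apply/orP; right.
have m_ge := gibbs_ge_of_setC_le Zoo (measurable_eball rho) r0 rhor.
have mE := gibbs_fineE Zoo (@measurable_eball R d rho).
set m := fine _ in mE.
have m0 : 0 < m.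
  rewrite -lte_fin -mE; apply: lt_le_trans m_ge.
  by rewrite lte_fin invr_gt0 ltr_wpDl// ltW.
rewrite /Psi2 mE -EFin_expe inver gt_eqF ?exprn_gt0// muleA -EFinM.
set s := ereal_sup _.
suff [b sb] : exists b : R, (s <= b%:E)%E.
  apply: le_lt_trans (lee_wpmul2l _ sb) _; last by rewrite -EFinM ltry.
  by rewrite lee_fin mulr_ge0// invr_ge0 sqr_ge0.
set I := (\int[lam]_(x in eball rho) (expR (- 2 * V x))%:E)%E.
have I0 : (0 <= I)%E by apply: integral_ge0 => x _; rewrite lee_fin expR_ge0.
have IE : I = (fine I)%:E by rewrite fineK// ge0_fin_numE//; exact: V2oo.
exists ((2 * rho) `^ p * fine I).
apply: ge_ereal_sup => _ [x xr <-].
have mV2 : measurable_fun setT (fun y : 'rV[R]_d => expR (- 2 * V y)).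
  by apply: measurableT_comp => //; exact: measurable_funM.
have rp0 : 0 <= (2 * rho) `^ p by exact: powR_ge0.
rewrite EFinM -IE /I -ge0_integralZl//;
  [|exact: measurable_eball|by apply/measurable_EFinP/measurable_funTS].
apply: ge0_le_integral => //.
- exact: measurable_eball.
- by move=> y _; rewrite lee_fin mulr_ge0 ?powR_ge0 ?expR_ge0.
- apply/measurable_EFinP/measurable_funTS; apply: measurable_funM => //.
  apply: (measurableT_comp (measurable_powR _)).
  exact: (measurableT_comp (measurableT_comp measurable_enorm measurable_rVB)
    (pair2_measurable x)).
- by apply/measurable_EFinP/measurable_funTS; exact: measurable_funM.
move=> y yr; rewrite lee_fin ler_wpM2r ?expR_ge0//; apply: ge0_ler_powR.
- by rewrite addr_ge0// ltW.
- by rewrite nnegrE enorm_ge0.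
- by rewrite nnegrE mulr_ge0// ltW.
- apply: le_trans (enormB_le _ _) _; rewrite ler_wpM2l//.
  by rewrite ge_max !ltW.
Qed.

End weak_poincare_betat.

(** * The super Poincare inequality near and away from the origin *)

Lemma one_le_mul_expN (R : realType) (v H : R) : expR v <= H -> 1 <= H * expR (- v).
Proof.
by move=> vH; rewrite -(expRxMexpNx_1 v) ler_wpM2r ?expR_ge0.
Qed.

Lemma sqr_convex (R : realType) (l a b : R) : 0 <= l -> l <= 1 ->
  ((1 - l) * a + l * b) ^+ 2 <= (1 - l) * a ^+ 2 + l * b ^+ 2.
Proof.
move=> l0 l1; have l1' : 0 <= 1 - l by rewrite subr_ge0.
have := mulr_ge0 (mulr_ge0 l0 l1') (sqr_ge0 (a - b)); lra.
Qed.

Lemma lee_of_pmul2l_add (R : realType) (q c1 c2 : R) (I e b : \bar R) : 0 < q ->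
  0 <= c1 -> 0 <= c2 -> (0 <= e)%E -> (0 <= b)%E ->
  (q%:E * I <= (q * c1)%:E * e + (q * c2)%:E * b)%E ->
  (I <= c1%:E * e + c2%:E * b)%E.
Proof.
move=> q0 c10 c20 e0 b0 qI.
by rewrite -(@lee_pmul2l _ q%:E)// ge0_muleDr ?mule_ge0 ?lee_fin// !muleA -!EFinM.
Qed.

Section super_poincare_parts.
Context {R : realType} {d : nat}.
Variables (alpha : R) (V : {mfun 'rV[R]_d >-> R}).
Local Notation lam := (lebesgue_rV d).
Local Notation g x := (expR (- V x)).
Local Notation Z := (Zpart V).
Local Notation p := (d%:R + alpha).
Hypothesis d_gt0 : (0 < d)%N.
Hypothesis alpha_gt0 : 0 < alpha.
Hypothesis Zoo : (\int[lam]_x (g x)%:E < +oo)%E.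

(** [exp V] is the inverse of the continuous positive function [g], and a Euclidean
    ball is contained in a compact product of segments. *)
Lemma bounded_expV_ball (r : R) : continuous (fun x => g x) ->
  exists M, forall x, enorm x <= r -> expR (V x) <= M.
Proof.
move=> cg.
have cV : continuous (fun x => expR (V x)).
  move=> x; rewrite (_ : (fun x => expR (V x)) = (fun x => (g x)^-1)).
    apply: (continuous_comp (cg x)); apply: inv_continuous.
    by rewrite gt_eqF// expR_gt0.
  by apply/funext => y; rewrite -expRN opprK.
pose K := [set x : 'rV[R]_d | forall i, `[(- r), r]%classic (x ord0 i)].
have cK : compact K.
  exact: (@rV_compact R d (fun=> `[- r, r]%classic) (fun=> @segment_compact _ _ _)).
have cVK : compact ((fun x => expR (V x)) @` K).
  apply: continuous_compact => //; exact: continuous_subspaceT.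
have [M [_ MK]] := compact_bounded cVK.
exists (M + 1) => x xr; apply: le_trans (ler_norm _) _.
apply: MK; first by rewrite ltrDl.
exists x => // i; rewrite /= in_itv/= -ler_norml.
exact: le_trans (coord_le_enorm x i) xr.
Qed.

Definition ecball (r : R) : set 'rV[R]_d := [set x | enorm x <= r].

Variable f : 'rV[R]_d -> R.
Hypothesis mf : measurable_fun setT f.
Local Notation E := (stable_form alpha V f f).

Lemma measurable_ecball (r : R) : measurable (ecball r).
Proof.
have := @measurable_enorm R d measurableT _ (measurable_itv `]-oo, r]).
by rewrite setTI.
Qed.

Let dR : 0 < d%:R :> R. Proof. by rewrite ltr0n. Qed.

(** The cube attached to [x] consists of the points [(1 - l) x + l v] with [v] in
    the cube of half-side [rho / d], itself inside the ball of radius [rho]: by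
    convexity it stays in that ball, and with [l = t / (2 rho)] it is within [t]
    of [x] in every coordinate. *)
Lemma integral_sqr_ball_le (rho t H : R) : 1 <= rho -> 0 < t -> t <= 1 ->
  0 <= H -> (forall x, enorm x <= rho -> expR (V x) <= H) ->
  (\int[gibbs V]_(x in ecball rho) (f x ^+ 2)%:E <=
   (2 * d%:R `^ p * d%:R ^+ d * t `^ alpha)%:E * E +
   (2 * Z * d%:R ^+ d * t ^- d * H)%:E * (\int[gibbs V]_x `|f x|%:E) ^+ 2)%E.
Proof.
move=> rho1 t0 t1 H0 VH; have Z0 := Zpart_gt0 Zoo.
have rho0 : 0 < rho by exact: lt_le_trans rho1.
pose l := t / (2 * rho).
have l0 : 0 < l by rewrite divr_gt0// mulr_gt0.
have l1 : l <= 1 by rewrite ler_pdivrMr ?mulr_gt0//; nra.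
have l1' : 0 <= 1 - l by rewrite subr_ge0.
have lrho : l * rho = t / 2 by rewrite /l; field; rewrite gt_eqF.
clearbody l.
pose s := t / (2 * d%:R).
have s0 : 0 < s by rewrite divr_gt0// mulr_gt0.
have st : s <= t / 2.
  have d1 : 1 <= d%:R :> R by rewrite ler1n.
  rewrite /s ler_pdivrMr ?mulr_gt0//; nra.
pose K := (d%:R * t) `^ p.
have K0 : 0 <= K by exact: powR_ge0.
have key : (((2 * s) ^+ d)%:E * \int[gibbs V]_(x in ecball rho) (f x ^+ 2)%:E <=
   (2 * K)%:E * E + (2 * H * Z)%:E * (\int[gibbs V]_x `|f x|%:E) ^+ 2)%E.
  apply: (@local_super_poincare R d V Zoo alpha f mf _ (1 - l) s) => //.
  - exact: measurable_ecball.
  - exact: ltW.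
  move=> x y /= xrho xy; split.
    have exy : enorm (x - y) <= d%:R * t.
      apply: enorm_le_coord => i; rewrite !mxE.
      have -> : x ord0 i - y ord0 i = l * x ord0 i - (y ord0 i - (1 - l) * x ord0 i) by ring.
      apply: le_trans (ler_normB _ _) _; rewrite normrM (gtr0_norm l0).
      have := xy i; have := ler_wpM2l (ltW l0) (le_trans (coord_le_enorm x i) xrho).
      lra.
    have eK : enorm (x - y) `^ p <= K.
      apply: ge0_ler_powR exy; rewrite ?nnegrE ?enorm_ge0//.
        by rewrite addr_ge0// ltW.
      by rewrite mulr_ge0// ltW.
    have := ler_wpM2r (expR_ge0 (- V x)) eK.
    have := mulr_ge0 K0 (expR_ge0 (- V y)); lra.
  apply: one_le_mul_expN; apply: VH.
  pose v : 'rV[R]_d := \row_i ((y ord0 i - (1 - l) * x ord0 i) / l).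
  have vrho : enorm v <= rho.
    have -> : rho = d%:R * (rho / d%:R) by field; rewrite gt_eqF.
    apply: enorm_le_coord => i; rewrite mxE normrM normfV (gtr0_norm l0) ler_pdivrMr//.
    apply: le_trans (xy i) _; rewrite mulrAC mulrC [_ * l]mulrC lrho.
    by rewrite le_eqVlt; apply/orP; left; apply/eqP; rewrite /s; field; rewrite gt_eqF.
  move: xrho vrho; rewrite /ecball/= !ler_enorm ?(ltW rho0)// => xrho vrho.
  apply: (@le_trans _ _ (\sum_i ((1 - l) * x ord0 i ^+ 2 + l * v ord0 i ^+ 2))).
    apply: ler_sum => i _.
    have -> : y ord0 i = (1 - l) * x ord0 i + l * v ord0 i.
      by rewrite mxE; field; rewrite gt_eqF.
    exact: sqr_convex (ltW l0) l1.
  rewrite big_split/= -!mulr_sumr.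
  have -> : rho ^+ 2 = (1 - l) * rho ^+ 2 + l * rho ^+ 2 by ring.
  by apply: lerD; apply: ler_wpM2l => //; exact: ltW.
have q0 : 0 < (2 * s) ^+ d by rewrite exprn_gt0// mulr_gt0.
have qE : (2 * s) ^+ d * d%:R ^+ d = t ^+ d.
  by rewrite -exprMn; congr (_ ^+ _); rewrite /s; field; rewrite gt_eqF.
apply: (lee_of_pmul2l_add q0); last 1 first.
- have -> : (2 * s) ^+ d * (2 * d%:R `^ p * d%:R ^+ d * t `^ alpha) = 2 * K.
    transitivity (2 * d%:R `^ p * ((2 * s) ^+ d * d%:R ^+ d) * t `^ alpha); first by ring.
    rewrite qE /K powRM ?ltW// [t `^ p]powRD; last by rewrite (gt_eqF t0) implybT.
    by rewrite powR_mulrn ?ltW//; ring.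
  have -> : (2 * s) ^+ d * (2 * Z * d%:R ^+ d * t ^- d * H) = 2 * H * Z.
    transitivity (2 * Z * ((2 * s) ^+ d * d%:R ^+ d) * t ^- d * H); first by ring.
    by rewrite qE; field; rewrite expf_neq0// gt_eqF.
  exact: key.
- by rewrite !mulr_ge0 ?powR_ge0 ?exprn_ge0.
- by rewrite mulr_ge0// mulr_ge0 ?invr_ge0 ?exprn_ge0 ?(ltW t0)// !mulr_ge0 ?exprn_ge0 ?(ltW Z0).
- exact: stable_form_ge0.
- by rewrite expe_ge0// integral_ge0.
Qed.

(** Here the cube is the same for all [x] and lies in the unit ball, where [g] is
    at least [1 / H]; since [|x - y| <= 2 (1 + |x|)], the lower bound on the
    weight gives [|x - y|^p g x <= 2^p / theta <= K g y]. *)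
Lemma integral_sqr_ballC_le (rho theta H : R) : 1 <= rho -> 0 < theta ->
  0 <= H -> (forall x, enorm x <= 1 -> expR (V x) <= H) ->
  (forall x, rho < enorm x -> theta <= weight alpha V x) ->
  (\int[gibbs V]_(x in ~` ecball rho) (f x ^+ 2)%:E <=
   ((d%:R / 2) ^+ d * 2 * 2 `^ p * H / theta)%:E * E +
   ((d%:R / 2) ^+ d * 2 * H * Z)%:E * (\int[gibbs V]_x `|f x|%:E) ^+ 2)%E.
Proof.
move=> rho1 theta0 H0 VH wtheta; have Z0 := Zpart_gt0 Zoo.
pose K := 2 `^ p * H / theta.
have K0 : 0 <= K by rewrite divr_ge0 ?mulr_ge0 ?powR_ge0// ltW.
have key : (((2 * d%:R^-1) ^+ d)%:E *
    \int[gibbs V]_(x in ~` ecball rho) (f x ^+ 2)%:E <=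
   (2 * K)%:E * E + (2 * H * Z)%:E * (\int[gibbs V]_x `|f x|%:E) ^+ 2)%E.
  apply: (@local_super_poincare R d V Zoo alpha f mf _ 0 d%:R^-1) => //.
  - by apply: measurableC; exact: measurable_ecball.
  move=> x y /= /negP; rewrite -ltNge => xrho xy.
  have y1 : enorm y <= 1.
    rewrite -(divff (lt0r_neq0 dR)); apply: enorm_le_coord => i.
    by have := xy i; rewrite mul0r subr0.
  have Hy : 1 <= H * g y by apply: one_le_mul_expN; exact: VH.
  split=> //.
  have gx : g x * (1 + enorm x) `^ p <= theta^-1.
    by rewrite -weightV lef_pV2 ?posrE ?weight_gt0//; exact: wtheta.
  have exy : enorm (x - y) <= 2 * (1 + enorm x).
    apply: le_trans (enormB_le _ _) _; rewrite ler_wpM2l// ge_max.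
    by apply/andP; split; lra.
  have e2 : enorm (x - y) `^ p <= 2 `^ p * (1 + enorm x) `^ p.
    rewrite -powRM ?(ltW (one_plus_enorm_gt0 _))//.
    apply: ge0_ler_powR exy; rewrite ?nnegrE ?enorm_ge0//.
      by rewrite addr_ge0// ltW.
    by rewrite mulr_ge0// ltW// one_plus_enorm_gt0.
  apply: (@le_trans _ _ (2 `^ p / theta)).
    have := ler_wpM2l (expR_ge0 (- V x)) e2.
    have := ler_wpM2l (powR_ge0 2 p) gx; lra.
  have c0 : 0 <= 2 `^ p / theta by rewrite divr_ge0 ?powR_ge0// ltW.
  have KE : K = 2 `^ p / theta * H by rewrite /K mulrAC.
  have := ler_wpM2l c0 Hy; have := mulr_ge0 K0 (expR_ge0 (- V x)).
  by rewrite KE; lra.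
have q0 : 0 < (2 * d%:R^-1 : R) ^+ d by rewrite exprn_gt0// mulr_gt0 ?invr_gt0.
have qV : (2 * d%:R^-1 : R) ^+ d * (d%:R / 2) ^+ d = 1.
  by rewrite -exprMn -[RHS](expr1n _ d); congr (_ ^+ _); field; rewrite gt_eqF.
have c0 : 0 <= (d%:R / 2 : R) ^+ d by rewrite exprn_ge0// divr_ge0.
apply: (lee_of_pmul2l_add q0); last 1 first.
- have -> : (2 * d%:R^-1) ^+ d * ((d%:R / 2) ^+ d * 2 * 2 `^ p * H / theta) = 2 * K.
    by rewrite !mulrA qV mul1r.
  have -> : (2 * d%:R^-1) ^+ d * ((d%:R / 2) ^+ d * 2 * H * Z) = 2 * H * Z.
    by rewrite !mulrA qV mul1r.
  exact: key.
- by rewrite divr_ge0 ?(ltW theta0)// !mulr_ge0 ?powR_ge0.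
- by rewrite !mulr_ge0 ?(ltW Z0).
- exact: stable_form_ge0.
- by rewrite expe_ge0// integral_ge0.
Qed.

End super_poincare_parts.

(** * The rate function of the super Poincare inequality *)

Section super_poincare_beta.
Context {R : realType} {d : nat}.
Variables (alpha : R) (V : {mfun 'rV[R]_d >-> R}).
Local Notation lam := (lebesgue_rV d).
Local Notation g x := (expR (- V x)).
Local Notation Z := (Zpart V).
Local Notation p := (d%:R + alpha).
Local Notation q := (d%:R / alpha).
Hypothesis d_gt0 : (0 < d)%N.
Hypothesis alpha_gt0 : 0 < alpha.
Hypothesis Zoo : (\int[lam]_x (g x)%:E < +oo)%E.

Let dR : 0 < d%:R :> R. Proof. by rewrite ltr0n. Qed.

(** The choice [t = (r / (2 a1))^(1/alpha)] makes the factor of the form inside the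
    ball equal to [r / 2], as the assumed bound on the weight does outside. *)
Lemma super_poincare_split (f : 'rV[R]_d -> R) (r rho H1 H : R) :
  let a1 := 2 * d%:R `^ p * d%:R ^+ d in
  let a2 := (d%:R / 2) ^+ d * 2 * 2 `^ p * H1 in
  measurable_fun setT f -> 1 <= rho -> 0 < r -> r <= 2 * a1 -> 0 <= H ->
  0 < H1 -> (forall x, enorm x <= 1 -> expR (V x) <= H1) ->
  (forall x, enorm x <= rho -> expR (V x) <= H) ->
  (forall x, rho < enorm x -> 2 * a2 / r <= weight alpha V x) ->
  (\int[gibbs V]_x (f x ^+ 2)%:E <= r%:E * stable_form alpha V f f +
    (2 * Z * d%:R ^+ d * (2 * a1) `^ q * H * r `^ (- q) +
     (d%:R / 2) ^+ d * 2 * H1 * Z)%:E * (\int[gibbs V]_x `|f x|%:E) ^+ 2)%E.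
Proof.
move=> a1 a2 mf rho1 r0 ra1 H0 H10 VH1 VH wr; have Z0 := Zpart_gt0 Zoo.
have a10 : 0 < a1 by rewrite mulr_gt0 ?exprn_gt0// mulr_gt0// powR_gt0.
have a20 : 0 < a2.
  by rewrite mulr_gt0// mulr_gt0 ?powR_gt0// mulr_gt0// exprn_gt0// divr_gt0.
pose t := (r / (2 * a1)) `^ alpha^-1.
have t0 : 0 < t by rewrite powR_gt0// divr_gt0// mulr_gt0.
have ra0 : 0 <= r / (2 * a1) by rewrite divr_ge0 ?mulr_ge0// ltW.
have t1 : t <= 1.
  have e1 : (1 : R) `^ alpha^-1 = 1 by rewrite powR1.
  rewrite -[leRHS]e1; apply: ge0_ler_powR; rewrite ?nnegrE//.
    by rewrite invr_ge0 ltW.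
  by rewrite ler_pdivrMr ?mul1r// mulr_gt0.
have ta : a1 * t `^ alpha = r / 2.
  have aux a : 0 < a -> a * (r / (2 * a)) = r / 2 by move=> a_gt0; field; rewrite gt_eqF.
  by rewrite /t -powRrM mulVf ?gt_eqF// powRr1// aux.
have td : t ^- d = (2 * a1) `^ q * r `^ (- q).
  have aV : (2 * a1)^-1 = (2 * a1) `^ (-1) by rewrite powR_inv1// mulr_ge0// ltW.
  rewrite -powR_mulrn ?(ltW t0)// /t -powRrM -powRN powRM//; last 2 first.
  - exact: ltW.
  - by rewrite invr_ge0 mulr_ge0// ltW.
  rewrite mulrC aV -powRrM.
  by congr (_ `^ _ * _ `^ _); ring.
have theta0 : 0 < 2 * a2 / r by rewrite divr_gt0// mulr_gt0.
have mB := @measurable_ecball R d rho.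
have i1 := integral_sqr_ball_le d_gt0 alpha_gt0 Zoo mf rho1 t0 t1 H0 VH.
have i2 := integral_sqr_ballC_le d_gt0 alpha_gt0 Zoo mf rho1 theta0 (ltW H10) VH1 wr.
apply: (@le_trans _ _
  (\int[gibbs V]_(x in ecball rho `|` ~` ecball rho) (f x ^+ 2)%:E)%E).
  by rewrite setUv.
rewrite ge0_integral_setU//; last 4 first.
- exact: measurableC.
- by rewrite setUv; apply/measurable_EFinP; exact: measurable_funX.
- by move=> x _; rewrite lee_fin sqr_ge0.
- by apply/disj_setPS; rewrite setICr.
apply: le_trans (leeD i1 i2) _.
have E0 := stable_form_ge0 V alpha f.
have b0 : (0 <= (\int[gibbs V]_x `|f x|%:E) ^+ 2)%E by rewrite expe_ge0// integral_ge0.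
move: (stable_form alpha V f f) E0 => E E0.
move: ((\int[gibbs V]_x `|f x|%:E) ^+ 2)%E b0 => b b0.
have -> : (d%:R / 2) ^+ d * 2 * 2 `^ p * H1 / (2 * a2 / r) = r / 2.
  have aux a : 0 < a -> a / (2 * a / r) = r / 2 by move=> a_gt0; field; rewrite !gt_eqF.
  exact: aux.
rewrite -/a1 ta td.
set k2 := (d%:R / 2) ^+ d * 2 * H1 * Z.
have k20 : 0 <= k2.
  by rewrite mulr_ge0 ?(ltW Z0)// mulr_ge0 ?(ltW H10)// mulr_ge0// exprn_ge0// divr_ge0// ltW.
have -> : 2 * Z * d%:R ^+ d * ((2 * a1) `^ q * r `^ (- q)) * H =
    2 * Z * d%:R ^+ d * (2 * a1) `^ q * H * r `^ (- q) by ring.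
set k1 := _ * r `^ (- q).
have k10 : 0 <= k1.
  rewrite mulr_ge0 ?powR_ge0// mulr_ge0// mulr_ge0 ?powR_ge0// mulr_ge0 ?exprn_ge0// ?(ltW dR)//.
  by rewrite mulr_ge0// ltW.
have r20 : 0 <= r / 2 by rewrite divr_ge0// ltW.
rewrite addeACA -!ge0_muleDl ?lee_fin// -!EFinD.
by have -> : r / 2 + r / 2 = r by field.
Qed.

(** The upper bound [M0] on [g] is what keeps [h] away from 0. *)
Lemma hV_HV_fin (rho M0 : R) : 0 <= rho -> (forall x, g x <= M0) ->
  continuous (fun x => g x) ->
  exists h H, [/\ hV V rho%:E = h%:E, HV V rho%:E = H%:E, 0 < h, h <= H &
    forall x, enorm x <= rho -> expR (V x) <= H].
Proof.
move=> rho0 gM cg.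
have M00 : 0 < M0 by exact: lt_le_trans (expR_gt0 _) (gM 0).
have [M VM] := bounded_expV_ball rho cg.
have in0 : [set x : 'rV[R]_d | ((enorm x)%:E <= rho%:E)%E] 0 by rewrite /= enorm0 lee_fin.
have Hub : (HV V rho%:E <= M%:E)%E.
  by apply: ge_ereal_sup => _ [x xr <-]; rewrite lee_fin VM// -lee_fin.
have H0 : ((expR (V 0))%:E <= HV V rho%:E)%E by apply: ereal_sup_ubound; exists 0.
have h0 : (hV V rho%:E <= (expR (V 0))%:E)%E by apply: ereal_inf_lbound; exists 0.
have hlb : ((M0^-1)%:E <= hV V rho%:E)%E.
  apply: le_ereal_inf_tmp => _ [x xr <-].
  by rewrite lee_fin -[expR (V x)]invrK lef_pV2 ?posrE ?invr_gt0 ?expR_gt0// -expRN.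
have VH x : enorm x <= rho -> ((expR (V x))%:E <= HV V rho%:E)%E.
  by move=> xr; apply: ereal_sup_ubound; exists x => //=; rewrite lee_fin.
move: (HV V rho%:E) (hV V rho%:E) Hub H0 h0 hlb VH => [H||] [h||]//.
rewrite !lee_fin => _ H0 h0 hlb VH; exists h, H; split => //.
- by apply: lt_le_trans hlb; rewrite invr_gt0.
- exact: le_trans h0 H0.
Qed.

(** The value is finite because [Phi] tends to infinity, and at least 1 because
    [Phi] is below [theta] on [[0, 1[].  Beyond it, every [x] has norm larger than
    some [s] with [Phi s >= theta], and [Phi s] bounds its weight from below. *)
Lemma PhiV_inv_fin (theta w1 : R) (x1 : 'rV[R]_d) :
  PhiV alpha V r @[r --> +oo] --> +oo%E ->
  1 <= enorm x1 -> weight alpha V x1 < theta ->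
  exists rho, [/\ 1 <= rho, PhiV_inv alpha V theta = rho%:E &
    forall x, rho < enorm x -> theta <= weight alpha V x].
Proof.
move=> Phioo x11 wtheta.
have Phi_le s x : s <= enorm x -> (PhiV alpha V s <= (weight alpha V x)%:E)%E.
  by move=> sx; apply: ereal_inf_lbound; exists x.
have lb : (1%:E <= PhiV_inv alpha V theta)%E.
  apply: le_ereal_inf_tmp => _ [s [s0 sPhi] <-]; rewrite lee_fin leNgt; apply/negP => s1.
  have := le_trans sPhi (Phi_le s x1 (ltW (lt_le_trans s1 x11))).
  by rewrite lee_fin leNgt wtheta.
have [s0 [s00 s0Phi]] : exists s, 0 <= s /\ (theta%:E <= PhiV alpha V s)%E.
  move/cvgeyPge : Phioo => /(_ theta) [M [_ MPhi]].
  exists (Num.max (M + 1) 0); rewrite le_max lexx orbT; split => //.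
  by apply: MPhi; rewrite lt_max ltrDl ltr01.
have ub : (PhiV_inv alpha V theta <= s0%:E)%E by apply: ereal_inf_lbound; exists s0.
case rhoE : (PhiV_inv alpha V theta) lb ub => [rho||]// lb _.
exists rho; split => // x rhox.
have : (PhiV_inv alpha V theta < (enorm x)%:E)%E by rewrite rhoE lte_fin.
move=> /ereal_inf_lt [_ [s [_ sPhi] <-]]; rewrite lte_fin => sx.
by rewrite -lee_fin; apply: le_trans sPhi (Phi_le s x (ltW sx)).
Qed.

(** [super_poincare_split] applies for [r <= r0], where the generalised inverse is
    at least 1.  For larger [r] the inequality at [r0] is enough, its constant
    [k3] being at most [c1]. *)
Lemma super_poincare_beta (M0 : R) :
  continuous (fun x => g x) -> (forall x, g x <= M0) ->
  PhiV alpha V r @[r --> +oo] --> +oo%E ->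
  exists c1 c2 : R, [/\ 0 < c1, 0 < c2 & super_poincare alpha V (beta alpha V c1 c2)].
Proof.
move=> cg gM Phioo; have Z0 := Zpart_gt0 Zoo.
have [H1 VH1] := bounded_expV_ball 1 cg.
have H10 : 0 < H1.
  by apply: lt_le_trans (expR_gt0 (V 0)) (VH1 0 _); rewrite enorm0.
pose x1 : 'rV[R]_d := const_mx 1.
have x11 : 1 <= enorm x1.
  by have := coord_le_enorm x1 (Ordinal d_gt0); rewrite mxE normr1.
pose w1 := weight alpha V x1; have w10 : 0 < w1 by exact: weight_gt0.
pose a1 := 2 * d%:R `^ p * d%:R ^+ d : R.
pose a2 := (d%:R / 2) ^+ d * 2 * 2 `^ p * H1 : R.
have a10 : 0 < a1 by rewrite mulr_gt0 ?exprn_gt0// mulr_gt0// powR_gt0.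
have a20 : 0 < a2.
  by rewrite mulr_gt0// mulr_gt0 ?powR_gt0// mulr_gt0// exprn_gt0// divr_gt0.
pose r0 := Num.min (2 * a1) (a2 / w1).
have r00 : 0 < r0 by rewrite lt_min mulr_gt0//= divr_gt0.
have small r : 0 < r -> r <= r0 -> exists rho,
    [/\ 1 <= rho, PhiV_inv alpha V (2 * a2 / r) = rho%:E &
    forall x, rho < enorm x -> 2 * a2 / r <= weight alpha V x].
  move=> r_gt0; rewrite le_min => /andP[_ rw].
  apply: (@PhiV_inv_fin _ 0 x1) => //.
  rewrite ltr_pdivlMr//; move: rw; rewrite ler_pdivlMr// -/w1; nra.
pose k1 := 2 * Z * d%:R ^+ d * (2 * a1) `^ q.
pose k2 := (d%:R / 2) ^+ d * 2 * H1 * Z.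
have k10 : 0 <= k1.
  rewrite mulr_ge0 ?powR_ge0// mulr_ge0 ?exprn_ge0 ?(ltW dR)//.
  by rewrite mulr_ge0// ltW.
have k20 : 0 <= k2.
  by rewrite mulr_ge0 ?(ltW Z0)// mulr_ge0 ?(ltW H10)// mulr_ge0// exprn_ge0// divr_ge0// ltW.
have split_le r (f : 'rV[R]_d -> R) rho h H : 0 < r -> r <= r0 -> measurable_fun setT f -> 1 <= rho ->
    (forall x, rho < enorm x -> 2 * a2 / r <= weight alpha V x) ->
    0 < h -> h <= H -> (forall x, enorm x <= rho -> expR (V x) <= H) ->
    (\int[gibbs V]_x (f x ^+ 2)%:E <= r%:E * stable_form alpha V f f +
      (k1 * H * r `^ (- q) + k2)%:E * (\int[gibbs V]_x `|f x|%:E) ^+ 2)%E.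
  move=> r_gt0; rewrite le_min => /andP[ra1 _] mf rho1 wr h0 hH VH.
  by apply: (super_poincare_split mf rho1) => //; exact: le_trans (ltW h0) hH.
have [rho0 [rho01 _ w0]] := small r0 r00 (lexx r0).
have [h0 [H0 [_ _ h00 hH0 VH0]]] := hV_HV_fin (le_trans ler01 rho01) gM cg.
pose k3 := k1 * H0 * r0 `^ (- q) + k2.
have k30 : 0 <= k3 by rewrite addr_ge0// mulr_ge0 ?powR_ge0// mulr_ge0// (le_trans _ hH0)// ltW.
exists (1 + k1 + k3), (2 * a2); split; [|by rewrite mulr_gt0|].
  by rewrite ltr_wpDr// ltr_wpDr.
move=> r f r_gt0 [mf f2oo Eoo].
have E_ge0 := stable_form_ge0 V alpha f.
have b_ge0 : (0 <= (\int[gibbs V]_x `|f x|%:E) ^+ 2)%E by rewrite expe_ge0// integral_ge0.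
have k2_le : k2 <= k3.
  by rewrite lerDr mulr_ge0 ?powR_ge0// mulr_ge0// (le_trans _ hH0)// ltW.
have [rr0|r0r] := leP r r0; last first.
  apply: le_trans (split_le r0 f rho0 h0 H0 r00 (lexx _) mf rho01 w0 h00 hH0 VH0) _.
  apply: leeD; first by rewrite lee_wpmul2r// lee_fin ltW.
  rewrite lee_wpmul2r// -/k3 /beta.
  apply: (@le_trans _ _ ((1 + k1 + k3)%:E * 1)%E).
    by rewrite mule1 lee_fin lerDr addr_ge0.
  apply: lee_wpmul2l; first by rewrite lee_fin addr_ge0// addr_ge0.
  rewrite leeDl// mule_ge0 ?poweR_ge0//.
  by rewrite mule_ge0 ?poweR_ge0// lee_fin powR_ge0.
have [rho [rho1 rhoE wr]] := small r r_gt0 rr0.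
have [h [H [hE HE h_gt0 hH VH]]] := hV_HV_fin (le_trans ler01 rho1) gM cg.
apply: le_trans (split_le r f rho h H r_gt0 rr0 mf rho1 wr h_gt0 hH VH) _.
rewrite leeD2l// lee_wpmul2r// /beta rhoE hE HE !poweR_EFin.
have -> : ((1 + k1 + k3)%:E * (1 + (r `^ (- q))%:E * (h `^ (- 1 - q))%:E * (H `^ (2 + q))%:E) =
    ((1 + k1 + k3) * (1 + r `^ (- q) * h `^ (- 1 - q) * H `^ (2 + q)))%:E)%E by [].
rewrite lee_fin.
have H_gt0 : 0 < H by exact: lt_le_trans hH.
have H_le : H <= h `^ (- 1 - q) * H `^ (2 + q).
  have -> : - 1 - q = - (1 + q) by ring.
  have -> : 2 + q = 1 + (1 + q) by ring.
  have q10 : 0 <= 1 + q by rewrite addr_ge0// divr_ge0// ltW.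
  rewrite powRN [H `^ _]powRD; last by rewrite (gt_eqF H_gt0) implybT.
  rewrite powRr1 ?(ltW H_gt0)// mulrCA ler_peMr ?(ltW H_gt0)//.
  rewrite mulrC ler_pdivlMr ?powR_gt0// mul1r.
  by apply: ge0_ler_powR; rewrite ?nnegrE ?(ltW h_gt0) ?(ltW H_gt0).
have rq0 := powR_ge0 r (- q).
have : r `^ (- q) * H <= r `^ (- q) * (h `^ (- 1 - q) * H `^ (2 + q)).
  by rewrite ler_wpM2l.
set X := h `^ (- 1 - q) * H `^ (2 + q) => rX.
have rX0 : 0 <= r `^ (- q) * X by apply: le_trans rX; rewrite mulr_ge0// ltW.
have aux (a b c u y : R) : 0 <= a -> 0 <= c -> b <= c -> u <= y -> 0 <= y ->
    a * u + b <= (1 + a + c) * (1 + y).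
  move=> a_ge0 c_ge0 bc uy y_ge0; have := ler_wpM2l a_ge0 uy.
  have := mulr_ge0 c_ge0 y_ge0; nra.
rewrite -[k1 * H * _]mulrA [H * _]mulrC -[_ * h `^ _ * _]mulrA -/X.
exact: aux.
Qed.

End super_poincare_beta.

(** * The theorem *)

Theorem theorem1p1 (R : realType) (d : nat) (d_gt0 : (0 < d)%N) :
  (forall (alpha : R) (V : {mfun 'rV[R]_d >-> R}),
    0 < alpha < 2 ->
    (\int[lebesgue_rV d]_x (expR (- V x))%:E < +oo)%E ->
    (Cb 2 (fun x => expR (- V x)) -> decay_condition alpha V ->
       (0 < PhiV alpha V 0)%E ->
       exists C : R, 0 < C /\ poincare alpha V C)
    /\
    (Cb 2 (fun x => expR (- V x)) -> decay_condition alpha V ->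
       PhiV alpha V r @[r --> +oo] --> +oo%E ->
       exists c1 c2 : R, [/\ 0 < c1, 0 < c2 &
         super_poincare alpha V (beta alpha V c1 c2)]))
  /\
  (exists c : R, 0 < c /\
    forall (alpha : R) (V : {mfun 'rV[R]_d >-> R}),
      0 < alpha < 2 ->
      (\int[lebesgue_rV d]_x (expR (- V x))%:E < +oo)%E ->
      weak_poincare alpha V (betat alpha V c)
      /\
      ((forall rho : R,
          (\int[lebesgue_rV d]_(x in eball rho) (expR (- 2 * V x))%:E < +oo)%E) ->
       forall r : R, 0 < r -> (betat alpha V c r < +oo)%E)).
Proof.
split=> [alpha V /andP[alpha0 alpha2] Zoo|].
  split=> [_ _ Phi0|[cg [M gM] _] _ Phioo].
    have [theta theta0 thetaPhi] : exists2 theta : R, 0 < theta &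
        (theta%:E <= PhiV alpha V 0)%E.
      case: (PhiV alpha V 0) Phi0 => [t t0||//]; first by exists t.
      by exists 1 => //; rewrite leey.
    have Z0 := Zpart_gt0 Zoo.
    exists (2 * (2 `^ (d%:R + alpha) / theta) / Zpart V); split.
      by rewrite divr_gt0// mulr_gt0// divr_gt0// powR_gt0.
    apply: poincare_of_weight_ge => // x.
    rewrite -lee_fin; apply: le_trans thetaPhi _.
    by apply: ereal_inf_lbound; exists x => //=; exact: enorm_ge0.
  apply: (super_poincare_beta d_gt0 alpha0 Zoo cg) => //.
  by move=> x; exact: le_trans (ler_norm _) (gM x).
exists (16 * d%:R ^+ d * 2 ^+ d.+2); split.
  by rewrite mulr_gt0 ?exprn_gt0// mulr_gt0 ?exprn_gt0 ?ltr0n.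
move=> alpha V /andP[alpha0 /ltW alpha2] Zoo; split.
  exact: weak_poincare_betat.
by move=> V2oo r r0; exact: betat_lty.
Qed.
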